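(* Let $\sigma,\omega$ be locally finite Borel measures on $\mathbb{R}^d$, let $\lambda=\{\lambda_Q\}_{Q\in\mathcal{D}}$ be a family of non-negative reals, and let $p\in(1,\infty)$, $q\in(0,\infty)$ with $q<p$. The following assertions hold. (i) (Sufficient condition) There is a constant $c$ depending only on $p,q$ such that $$\|M_\lambda(\cdot\,\sigma)\|_{L^p(\sigma)\to L^q(\omega)}\le c\left(\int \sup_{Q\in\mathcal{D}}\Big(\frac{\omega(Q)}{\sigma(Q)}\Big)^{\frac{q}{p-q}}\lambda_Q^q\,(\Lambda^{\sup}_{q,Q})^{\frac{q^2}{p-q}}1_Q\,d\omega\right)^{\frac{p-q}{pq}}.$$ (ii) (Necessary condition) Let $\epsilon>0$ be an arbitrarily small positive real. There is a constant $c$ depending only on $\epsilon,p,q$ such that $$\left(\int \sup_{Q\in\mathcal{D}}\Big(\frac{\omega(Q)}{\sigma(Q)}\Big)^{\frac{q}{p-q}}(\Lambda^{\sup}_{q-\epsilon,Q})^{\frac{pq}{p-q}}1_Q\,d\omega\right)^{\frac{p-q}{pq}}\le c\,\|M_\lambda(\cdot\,\sigma)\|_{L^p(\sigma)\to L^q(\omega)}.$$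
   Context: $\mathcal{D}$ is the collection of all dyadic cubes in $\mathbb{R}^d$. For a measure $\mu$ and $Q\in\mathcal D$, $\langle f\rangle^\mu_Q:=\frac{1}{\mu(Q)}\int_Q|f|\,d\mu$. The dyadic maximal operator is $M_\lambda(f\sigma):=\sup_{Q\in\mathcal{D}}\lambda_Q\langle f\rangle^\sigma_Q1_Q$, and $\|M_\lambda(\cdot\,\sigma)\|_{L^p(\sigma)\to L^q(\omega)}$ is the least constant $C$ such that $\|M_\lambda(f\sigma)\|_{L^q(\omega)}\le C\|f\|_{L^p(\sigma)}$ for all $f\in L^p(\sigma)$ (where $\|f\|_{L^q(\omega)}=(\int|f|^q\,d\omega)^{1/q}$ for every $q\in(0,\infty)$). For $\gamma\in\mathbb{R}\setminus\{0\}$, $$\Lambda^{\sup}_{\gamma,Q}:=\Big(\frac{1}{\omega(Q)}\int_Q\big(\sup_{R\in\mathcal{D}:R\subseteq Q}\lambda_R1_R\big)^\gamma d\omega\Big)^{1/\gamma}.$$ Convention: $\frac00:=0$.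
   Formalization: In (ii) it is additionally assumed that λ_Q = 0 for every dyadic Q with σ(Q) = 0 < ω(Q); otherwise, since 0/0 = 0, the operator does not see λ_Q while Λ^sup does, and (ii) fails. Also q − ε ≠ 0, so that Λ^sup is defined. *)

(* Defs.v *)
From HB Require Import structures.
From mathcomp Require Import all_boot all_order all_algebra.
From mathcomp Require Import all_classical all_reals all_analysis.
Import Order.TTheory GRing.Theory Num.Theory.
Import numFieldNormedType.Exports.

Set Implicit Arguments.
Unset Strict Implicit.
Unset Printing Implicit Defensive.

Local Open Scope classical_set_scope.
Local Open Scope ring_scope.

Notation borel_space R d := (g_sigma_algebraType (@open 'rV[R]_d)).

Definition locally_finite (R : realType) (d : nat)
    (mu : set (borel_space R d) -> \bar R) : Prop :=
  forall x : 'rV[R]_d,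
    exists2 U : set 'rV[R]_d, open_nbhs x U & (mu U < +oo)%E.

Definition dyadic_cube (R : realType) (d : nat) (k : int) (m : 'rV[int]_d)
    : set 'rV[R]_d :=
  [set x | forall i : 'I_d,
     (m ord0 i)%:~R * 2 ^ (- k) <= x ord0 i < (m ord0 i + 1)%:~R * 2 ^ (- k)].

Definition dyadic (R : realType) (d : nat) : set (set 'rV[R]_d) :=
  [set Q | exists k m, Q = @dyadic_cube R d k m].

Local Open Scope ereal_scope.

(* Power of x in [0, +oo] to a possibly negative exponent, with
   0 to a negative power equal to +oo and +oo to a negative power equal to 0
   (poweR gives 0 and +oo respectively). *)
Definition epow (R : realType) (x : \bar R) (r : R) : \bar R :=
  if (r < 0)%R then (x `^ (- r)%R)^-1 else x `^ r.

(* In \bar R, 0^-1 = +oo and 0 * +oo = 0, so that 0 / 0 = 0, whereas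
   x / 0 = +oo for x > 0. *)
Definition average (R : realType) (d : nat)
    (mu : {measure set (borel_space R d) -> \bar R})
    (f : 'rV[R]_d -> \bar R) (Q : set 'rV[R]_d) : \bar R :=
  (\int[mu]_(x in (Q : set (borel_space R d))) `|f x|) / mu Q.

(* Since 0 * +oo = 0, a cube Q with F Q = +oo contributes 0 outside Q. *)
Definition sup_cubes (R : realType) (d : nat) (D : set (set 'rV[R]_d))
    (F : set 'rV[R]_d -> \bar R) (x : 'rV[R]_d) : \bar R :=
  ereal_sup [set F Q * (\1_Q x)%:E | Q in D].

Definition maximal (R : realType) (d : nat) (lambda : set 'rV[R]_d -> R)
    (sigma : {measure set (borel_space R d) -> \bar R})
    (f : 'rV[R]_d -> R) : 'rV[R]_d -> \bar R :=
  sup_cubes (@dyadic R d)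
    (fun Q => (lambda Q)%:E * average sigma (EFin \o f) Q).

(* +oo when no finite constant is admissible; 'N[mu]_r%:E[f] is
   (\int |f|^r dmu)^(1/r) also for 0 < r < 1. *)
Definition maximal_norm (R : realType) (d : nat) (lambda : set 'rV[R]_d -> R)
    (sigma omega : {measure set (borel_space R d) -> \bar R}) (p q : R)
    : \bar R :=
  ereal_inf [set C%:E | C in [set C : R | (0 <= C)%R /\
    forall f : borel_space R d -> R, f \in Lfun sigma p%:E ->
      'N[omega]_q%:E[maximal lambda sigma f]
        <= C%:E * 'N[sigma]_p%:E[EFin \o f]]].

Definition Lambda_sup (R : realType) (d : nat) (lambda : set 'rV[R]_d -> R)
    (omega : {measure set (borel_space R d) -> \bar R})
    (gamma : R) (Q : set 'rV[R]_d) : \bar R :=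
  epow (average omega
          (fun x => epow (sup_cubes [set S | dyadic S /\ S `<=` Q]
                                    (fun S => (lambda S)%:E) x) gamma) Q)
       gamma^-1%R.

(* Main.v *)
Require Import Defs.
From mathcomp Require Import all_boot all_order all_algebra.
From mathcomp Require Import all_classical all_reals all_analysis.
From mathcomp Require Import measurable_realfun ring lra.
Import Order.TTheory GRing.Theory Num.Theory.
Import numFieldNormedType.Exports.

(** From a finite family of nested or disjoint cubes with weights [w] one can
    select a subfamily along whose decreasing chains [w] at least doubles, while
    every cube lies in a selected one of at least half its weight. On such a
    subfamily, with [w = u^(t-1)] and [u_Q <= <g>_Q], the sum of [u_Q^(t-1) 1_Q]
    is comparable to its largest term, whence
    [\sum_Q u_Q^t mu(Q) <= 4^t \int g^t dmu].

    Sufficiency. Put [m_Q = sup_(R <= Q) lambda_R 1_R] and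
    [I_Q = \int_Q m_Q^q domega]. For every [delta > 0] the cubes with
    [I_Q > delta <f>_Q^(p-q) sigma(Q)] contribute to [\int M(f sigma)^q domega]
    at most [delta^(-q/(p-q))] times the integral in the condition. The other
    cubes are grouped under selected cubes [P]; these contribute
    [\sum_P <f>_P^q I_P <= delta \sum_P <f>_P^p sigma(P)], up to a constant, and
    the last sum is at most [4^p \int |f|^p dsigma]. Then optimise [delta].

    Necessity. Let [G_Q] be the summand of the condition. Test the norm on
    [f = (\sum_P c_P^p 1_P)^(1/p)] with [c_P^p sigma(P) = G_P omega(P)], summed
    over cubes [P] on which [G] doubles, so that
    [\int f^p dsigma = Y := \sum_P G_P omega(P)]. Since [M(f sigma) >= c_P m_P]
    on [P], the averages over [P] of [M(f sigma)^a], [a < q], dominate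
    [G_P^(a/q)], hence [Y] is at most a constant times
    [\int M(f sigma)^q domega <= C^q Y^(q/p)]. As [q < p], this bounds [Y]. *)

Set Implicit Arguments.
Unset Strict Implicit.
Unset Printing Implicit Defensive.

Local Open Scope classical_set_scope.
Local Open Scope ring_scope.

(** * Selection of doubling subfamilies *)

(** Greedy choice from the lightest set to the heaviest. A set is skipped when a selected superset
    has at least half its weight; otherwise it is selected and the selected sets inside it are
    dropped. Those left are disjoint from it or contain it with at most half its weight, which is
    the doubling property. *)
Lemma doubling_subfamily (R : realFieldType) (T : Type) (w : set T -> R)
    (s : seq (set T)) :
  {in s, forall Q, 0 <= w Q} ->
  {in s &, forall P Q, [\/ P `<=` Q, Q `<=` P | P `&` Q = set0]} ->
  exists s0 : seq (set T), [/\ {subset s0 <= s},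
    {in s, forall Q, exists2 P, P \in s0 & Q `<=` P /\ w Q <= 2 * w P} &
    pairwise (fun P Q => `[< P `&` Q = set0 >] || (2 * w Q <= w P)) s0].
Proof.
pose r := fun P Q : set T => w Q <= w P.
(* With the heaviest sets first, induction on the list adds to a selection from the tail a set at
   least as heavy as all of them. *)
wlog : s / pairwise r s => [H w0 lam|].
  have rtr : transitive r by move=> y x z xy yz; exact: le_trans yz xy.
  have := sort_sorted (fun P Q => le_total (w Q) (w P)) s.
  rewrite (sorted_pairwise rtr) => /H[|A B|s0 [s0s cov pw]].
  - by move=> Q; rewrite mem_sort; exact: w0.
  - by rewrite !mem_sort; exact: lam.
  exists s0; split=> // [Q /s0s|Q Qs]; first by rewrite mem_sort.
  by apply: cov; rewrite mem_sort.
elim: s => [_ _ _|Q s IH]; first by exists [::]; split.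
rewrite pairwise_cons => /andP[/allP Qtop pw] w0 lam.
have [||s0 [s0s cov pw0]] := IH pw.
- by move=> A As; apply: w0; rewrite inE As orbT.
- by move=> A B As Bs; apply: lam; rewrite inE ?As ?Bs orbT.
have [[P Ps0 QP]|nQ] := pselect (exists2 P, P \in s0 & Q `<=` P /\ w Q <= 2 * w P).
  exists s0; split=> // [A /s0s As|A]; first by rewrite inE As orbT.
  by rewrite inE => /predU1P[->|/cov//]; exists P.
have wQ : 0 <= w Q by apply: w0; rewrite mem_head.
exists (Q :: [seq P <- s0 | ~~ `[< P `<=` Q >]]); split.
- move=> A; rewrite !inE mem_filter => /orP[->//|/andP[_ /s0s ->]].
  by rewrite orbT.
- move=> A; rewrite inE => /predU1P[->|As].
    by exists Q; rewrite ?mem_head; split=> //; lra.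
  have [P Ps0 [AP wAP]] := cov _ As.
  (* A set covered by a dropped [P] passes to [Q], which contains [P] and is at least as heavy as
     every set of the tail. *)
  have [PQ|PQ] := asboolP (P `<=` Q).
    exists Q; first by rewrite mem_head.
    split; first exact: subset_trans PQ.
    by have := Qtop _ As; rewrite /r; lra.
  by exists P => //; rewrite inE mem_filter Ps0 andbT asboolF ?orbT.
rewrite pairwise_cons pairwise_filter// andbT; apply/allP => P.
rewrite mem_filter => /andP[/asboolPn PQ Ps0].
have Ps : P \in Q :: s by rewrite inE (s0s _ Ps0) orbT.
have [QP|//|->] := lam Q P (mem_head _ _) Ps; last by rewrite asboolT.
(* Here [Q] lies in [P]; if [P] had more than half the weight of [Q] it would cover [Q], against
   [nQ]. *)
apply/orP; right; rewrite leNgt; apply/negP => wlt.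
by apply: nQ; exists P => //; split=> //; lra.
Qed.

(** Sets through [x] meet, so their weights at least halve along the list, and as in a geometric
    series the sum is at most twice the first of them. *)
Lemma sum_doubling (R : realFieldType) (T : Type) (w : set T -> R)
    (s : seq (set T)) (x : T) :
  {in s, forall Q, 0 <= w Q} ->
  pairwise (fun P Q => `[< P `&` Q = set0 >] || (2 * w Q <= w P)) s ->
  \sum_(Q <- s) w Q * \1_Q x = 0 \/
  exists P, [/\ P \in s, P x & \sum_(Q <- s) w Q * \1_Q x <= 2 * w P].
Proof.
elim: s => [_ _|P s IH]; first by left; rewrite big_nil.
move=> w0; rewrite pairwise_cons => /andP[/allP Pr pw].
have {}IH : \sum_(Q <- s) w Q * \1_Q x = 0 \/
  exists P, [/\ P \in s, P x & \sum_(Q <- s) w Q * \1_Q x <= 2 * w P].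
  by apply: IH => // Q Qs; apply: w0; rewrite inE Qs orbT.
rewrite big_cons indicE; have [xP|xP] := boolP (x \in P); last first.
  rewrite mulr0 add0r; case: IH => [|[A [As Ax le]]]; first by left.
  by right; exists A; rewrite inE As orbT.
right; exists P; rewrite mem_head mulr1; split=> //; first by rewrite inE in xP.
have wP := w0 _ (mem_head _ _).
case: IH => [->|[A [As Ax le]]]; first lra.
case/orP: (Pr _ As) => [/asboolP PA|]; last lra.
by have : (P `&` A) x; [split=> //; rewrite inE in xP|rewrite PA].
Qed.

Lemma powR_mulB1 (R : realType) (a t : R) : 0 <= a -> t != 0 ->
  a `^ t = a * a `^ (t - 1).
Proof.
move=> a0 t0; rewrite -{2}(powRr1 a0) -powRD; first by congr powR; lra.
by apply/implyP => /eqP e; case/eqP: t0; lra.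
Qed.

Lemma le_sum_indic (R : realFieldType) (T : Type) (c : set T -> R)
    (s : seq (set T)) (P : set T) (x : T) :
  (forall Q, 0 <= c Q) -> P \in s -> P x -> c P <= \sum_(Q <- s) c Q * \1_Q x.
Proof.
move=> c0 Ps Px; rewrite (big_rem P)//= indicE mem_set// mulr1 lerDl.
by apply: sumr_ge0 => Q _; rewrite mulr_ge0.
Qed.

(** By [sum_doubling] the left side is zero or at most [2 u_P^(t-1) g] for one [P] through [x]. For
    [4 g <= u_P] this is at most [u_P^t / 2]; otherwise [u_P^(t-1) <= (4 g)^(t-1)]. The factor [1/2]
    lets the first term be absorbed after integration. *)
Lemma young_doubling (R : realType) (T : Type) (t : R) (u : set T -> R)
    (s : seq (set T)) (g : R) (x : T) : 1 < t -> 0 <= g ->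
  {in s, forall Q, 0 <= u Q} ->
  pairwise (fun P Q => `[< P `&` Q = set0 >] ||
    (2 * u Q `^ (t - 1) <= u P `^ (t - 1))) s ->
  (\sum_(Q <- s) u Q `^ (t - 1) * \1_Q x) * g <=
  2^-1 * (\sum_(Q <- s) u Q `^ t * \1_Q x) + 2 * 4 `^ (t - 1) * g `^ t.
Proof.
move=> t1 g0 u0 pw.
have S0 : 0 <= \sum_(Q <- s) u Q `^ t * \1_Q x.
  by apply: sumr_ge0 => Q _; rewrite mulr_ge0 ?powR_ge0.
have K0 : 0 <= 2 * 4 `^ (t - 1) * g `^ t by rewrite !mulr_ge0 ?powR_ge0.
have t0 : t != 0 by rewrite gt_eqF//; lra.
have [//|->|[P [Ps Px le]]] := sum_doubling x _ pw.
- by move=> *; exact: powR_ge0.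
- by rewrite mul0r addr_ge0// mulr_ge0.
have uP := u0 _ Ps; apply: (le_trans (ler_wpM2r g0 le)).
have uS : u P `^ t <= \sum_(Q <- s) u Q `^ t * \1_Q x.
  by apply: (le_sum_indic (c := fun Q => u Q `^ t)) => // Q; exact: powR_ge0.
have [le4|lt4] := leP (4 * g) (u P).
  have le' : g * u P `^ (t - 1) <= 4^-1 * u P `^ t.
    rewrite (powR_mulB1 uP t0) mulrA ler_wpM2r ?powR_ge0//. lra.
  lra.
have le' : g * u P `^ (t - 1) <= 4 `^ (t - 1) * g `^ t.
  rewrite (powR_mulB1 g0 t0) mulrCA ler_wpM2l// -powRM//.
  apply: ge0_ler_powR; rewrite ?nnegrE ?mulr_ge0//; last exact: ltW.
  by rewrite subr_ge0 ltW.
lra.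
Qed.

(** * Dyadic cubes *)

(** Measured in the smaller side length all endpoints are integers, so the strict inequalities given
    by the common point [x] sharpen to weak ones between endpoints. *)
Lemma dyadic_cube_nested (R : realType) (d : nat) (j k : int)
    (m n : 'rV[int]_d) (x : 'rV[R]_d) :
  j <= k -> dyadic_cube j m x -> dyadic_cube k n x ->
  dyadic_cube k n `<=` (dyadic_cube j m : set 'rV[R]_d).
Proof.
move=> jk xm xn y yn i.
have [a kE] : exists a : nat, k = j + a%:Z.
  by exists `|k - j|%N; rewrite gez0_abs ?subr_ge0//; ring.
have kj : (2 : R) ^ (- j) = (2 ^+ a)%:~R * 2 ^ (- k).
  rewrite kE opprD expfzDr// mulrCA -exprnN rmorphXn/= mulfV ?mulr1//.
have h0 : 0 < (2 : R) ^ (- k) by rewrite exprz_gt0.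
have /andP[ml mu] := xm i; have /andP[nl nu] := xn i; have /andP[yl yu] := yn i.
rewrite kj !mulrA -!intrM in ml mu *.
have mn : (m ord0 i * 2 ^+ a)%:~R <= (n ord0 i)%:~R :> R.
  by rewrite ler_int -ltzD1 -(ltr_int R) -(ltr_pM2r h0) (le_lt_trans ml).
have nm : (n ord0 i + 1)%:~R <= ((m ord0 i + 1) * 2 ^+ a)%:~R :> R.
  by rewrite ler_int lezD1 -(ltr_int R) -(ltr_pM2r h0) (le_lt_trans nl).
apply/andP; split; first by apply: le_trans yl; rewrite ler_pM2r.
by apply: (lt_le_trans yu); rewrite ler_pM2r.
Qed.

Lemma dyadic_nested (R : realType) (d : nat) (P Q : set 'rV[R]_d) :
  dyadic P -> dyadic Q -> [\/ P `<=` Q, Q `<=` P | P `&` Q = set0].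
Proof.
move=> [j [m ->]] [k [n ->]].
have [->|/set0P[x [xm xn]]] :=
  eqVneq ((dyadic_cube j m : set 'rV[R]_d) `&` dyadic_cube k n) set0.
  by constructor 3.
have [jk|kj] := leP j k.
  by constructor 2; exact: dyadic_cube_nested xm xn.
by constructor 1; exact: dyadic_cube_nested (ltW kj) xn xm.
Qed.

Lemma dyadic_nonempty (R : realType) (d : nat) : @dyadic R d !=set0.
Proof. by exists (dyadic_cube 0 0), 0, 0. Qed.

Lemma countable_dyadic (R : realType) (d : nat) : countable (@dyadic R d).
Proof.
have : countable (range (fun km : int * 'rV[int]_d => @dyadic_cube R d km.1 km.2)).
  exact: sub_countable (card_image_le _ _) (countableP _).
apply: sub_countable; apply: subset_card_le => Q [k [m ->]].
by exists (k, m).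
Qed.

Lemma measurable_dyadic (R : realType) (d : nat) (Q : set (borel_space R d)) :
  dyadic Q -> measurable Q.
Proof.
move=> [k [m ->]].
pose L i := [set x : 'rV[R]_d | (m ord0 i)%:~R * 2 ^ (- k) <= x ord0 i].
pose U i := [set x : 'rV[R]_d | x ord0 i < (m ord0 i + 1)%:~R * 2 ^ (- k)].
have -> : dyadic_cube k m = \bigcap_(i in [set: 'I_d]) (L i `&` U i).
  apply/seteqP; split=> x /= xm i; first by move=> _; apply/andP/xm.
  by apply/andP; exact: xm.
have oU i : open (U i).
  apply: (open_comp (f := fun x : 'rV[R]_d => x ord0 i) _ (@open_lt R _)).
  by move=> x _; exact: coord_continuous.
have cL i : closed (L i).
  apply: (closed_comp (f := fun x : 'rV[R]_d => x ord0 i) _ (@closed_ge R _)).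
  by move=> x _; exact: coord_continuous.
apply: (@fin_bigcap_measurable _ (borel_space R d)) => // i _.
apply: measurableI.
  rewrite -[L i]setCK; apply: measurableC; apply: sub_sigma_algebra.
  exact: closed_openC.
exact: sub_sigma_algebra.
Qed.

(** * Finite measure of cubes and enumeration *)

Lemma dyadic_cube_sub_compact (R : realType) (d : nat) (k : int) (m : 'rV[int]_d) :
  exists2 K : set 'rV[R]_d, compact K & dyadic_cube k m `<=` K.
Proof.
exists [set v : 'rV[R]_d | forall i,
  v ord0 i \in `[(m ord0 i)%:~R * 2 ^ (- k), (m ord0 i + 1)%:~R * 2 ^ (- k)]].
  apply: (@rV_compact R d (fun i =>
    `[(m ord0 i)%:~R * 2 ^ (- k), (m ord0 i + 1)%:~R * 2 ^ (- k)]%classic)).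
  by move=> i; exact: segment_compact.
move=> x xm i; have /andP[xl xu] := xm i.
by rewrite in_itv/= xl ltW.
Qed.

(** A compact box containing the cube is covered by finitely many open sets of finite measure;
    subadditivity concludes. *)
Lemma locally_finite_dyadic (R : realType) (d : nat)
    (mu : {measure set (borel_space R d) -> \bar R}) (Q : set 'rV[R]_d) :
  locally_finite mu -> dyadic Q -> (mu Q < +oo)%E.
Proof.
move=> lf dQ; have mQ := measurable_dyadic dQ.
have /choice[U HU] : forall x : 'rV[R]_d, exists U : set 'rV[R]_d,
    open_nbhs x U /\ (mu U < +oo)%E.
  by move=> x; have [U xU fU] := lf x; exists U.
have [k [m QE]] := dQ; have [K cK QK] := dyadic_cube_sub_compact R k m.
move: cK; rewrite compact_cover => /(_ 'rV[R]_d setT U)[x _||D _ KD].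
- by have [[]] := HU x.
- by move=> x Kx; exists x => //; have [[]] := HU x.
have mU x : measurable (U x : set (borel_space R d)).
  by apply: sub_sigma_algebra; have [[]] := HU x.
have := finite_fset D; move: KD; set E := (X in cover X _) => KE finE.
have muQ : (mu Q <= \sum_(x \in E) mu (U x))%E.
  apply: content_sub_fsum => //.
  by rewrite QE => y /QK/KE.
apply: (le_lt_trans muQ).
rewrite fsbig_finite//=; apply: lte_sum_pinfty => x _.
by have [] := HU x.
Qed.

(** Turns countable families of cubes into sequences, with repetitions: an index that codes no
    element of [A] is sent to a fixed [a]. *)
Lemma countable_range (T : Type) (A : set T) :
  countable A -> A !=set0 -> exists e : nat -> T, range e = A.
Proof.
move=> /countable_injP[f finj] [a Aa].
have /choice[e eP] : forall n, exists b, A b /\ forall c, A c -> f c = n -> b = c.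
  move=> n; have [[b [Ab fb]]|nb] := pselect (exists b, A b /\ f b = n).
    by exists b; split=> // c Ac fc; apply: finj; rewrite ?inE// fc.
  by exists a; split=> // c Ac fc; exfalso; apply: nb; exists c.
exists e; apply/seteqP; split=> [_ [n _ <-]|c Ac]; first by have [] := eP n.
by exists (f c) => //; have [_ /(_ c)->] := eP (f c).
Qed.

Local Open Scope ereal_scope.

(** * Carleson embedding *)

Lemma ge0_integral_sum_in d (T : measurableType d) (R : realType)
    (mu : {measure set T -> \bar R}) (I : eqType) (f : I -> T -> \bar R)
    (s : seq I) :
  (forall i, i \in s -> measurable_fun [set: T] (f i)) ->
  {in s, forall i x, 0 <= f i x} ->
  \int[mu]_x (\sum_(i <- s) f i x) = \sum_(i <- s) \int[mu]_x f i x.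
Proof.
move=> mf f0; pose h i x := if i \in s then f i x else 0.
rewrite [RHS]big_seq -(@eq_bigr _ _ _ _ _ _ (fun i => \int[mu]_x h i x)).
  rewrite -big_seq -ge0_integral_sum//.
  - apply: eq_integral => x _; rewrite big_seq [RHS]big_seq.
    by apply: eq_bigr => i si; rewrite /h si.
  - move=> i; rewrite /h; case: (boolP (i \in s)) => [si|_].
      exact: mf.
    exact: measurable_cst.
  - by move=> i x _; rewrite /h; case: ifPn => // si; exact: f0.
by move=> i si; apply: eq_integral => x _; rewrite /h si.
Qed.

Lemma emeasurable_sum_in d (T : measurableType d) (R : realType) (I : eqType)
    (f : I -> T -> \bar R) (s : seq I) :
  (forall i, i \in s -> measurable_fun [set: T] (f i)) ->
  measurable_fun [set: T] (fun x => \sum_(i <- s) f i x).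
Proof.
elim: s => [_|i s IH mf].
  by under eq_fun do rewrite big_nil; exact: measurable_cst.
under eq_fun do rewrite big_cons.
apply: emeasurable_funD; first by apply: mf; rewrite mem_head.
by apply: IH => j js; apply: mf; rewrite inE js orbT.
Qed.

Lemma measurable_mul_indic d (T : measurableType d) (R : realType)
    (f : T -> \bar R) (Q : set T) :
  measurable_fun [set: T] f -> measurable Q ->
  measurable_fun [set: T] (fun x => f x * (\1_Q x)%:E).
Proof.
move=> mf mQ; apply: emeasurable_funM => //.
by apply/measurable_EFinP; exact: measurable_indic.
Qed.

Lemma integral_mul_indic d (T : measurableType d) (R : realType)
    (mu : {measure set T -> \bar R}) (f : T -> \bar R) (Q : set T) :
  \int[mu]_x (f x * (\1_Q x)%:E) = \int[mu]_(x in Q) f x.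
Proof. by rewrite [RHS]integral_mkcond epatch_indic. Qed.

Lemma integral_sum_indic d (T : measurableType d) (R : realType)
    (mu : {measure set T -> \bar R}) (c : set T -> R) (s : seq (set T)) :
  {in s, forall Q, measurable Q} -> {in s, forall Q, (0 <= c Q)%R} ->
  \int[mu]_x (\sum_(Q <- s) c Q * \1_Q x)%:E = \sum_(Q <- s) (c Q)%:E * mu Q.
Proof.
move=> ms c0; under eq_integral do rewrite -sumEFin.
rewrite ge0_integral_sum_in//.
- rewrite big_seq [RHS]big_seq; apply: eq_bigr => Q sQ.
  under eq_integral do rewrite EFinM.
  by rewrite integral_mul_indic integral_cst//; exact: ms.
- move=> Q sQ; under eq_fun do rewrite EFinM.
  by apply: measurable_mul_indic => //; exact: ms.
- by move=> Q sQ x; rewrite lee_fin mulr_ge0// c0.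
Qed.

Lemma measurable_sum_indic d (T : measurableType d) (R : realType)
    (c : set T -> R) (s : seq (set T)) :
  {in s, forall Q, measurable Q} ->
  measurable_fun [set: T] (fun x => \sum_(Q <- s) c Q * \1_Q x)%R.
Proof.
elim: s => [_|Q s IH ms].
  by under eq_fun do rewrite big_nil; exact: measurable_cst.
under eq_fun do rewrite big_cons.
apply: measurable_funD; last by apply: IH => A As; apply: ms; rewrite inE As orbT.
apply: measurable_funM => //; apply: measurable_indic; apply: ms.
by rewrite mem_head.
Qed.

(* The sum of [u Q `^ (t - 1)] over the members of [s] through a point is
   comparable to its largest term, so its product with [g] is absorbed by
   Young's inequality. *)
Lemma carleson_embedding d (T : measurableType d) (R : realType)
    (mu : {measure set T -> \bar R}) (t : R) (u : set T -> R)
    (s : seq (set T)) (g : T -> \bar R) :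
  (1 < t)%R -> measurable_fun [set: T] g -> (forall x, 0 <= g x) ->
  {in s, forall Q, measurable Q} -> {in s, forall Q, mu Q < +oo} ->
  {in s, forall Q, 0 <= u Q}%R ->
  pairwise (fun P Q => `[< P `&` Q = set0 >] ||
    (2 * u Q `^ (t - 1) <= u P `^ (t - 1))%R) s ->
  {in s, forall Q, (u Q)%:E * mu Q <= \int[mu]_(x in Q) g x} ->
  \sum_(Q <- s) (u Q `^ t)%:E * mu Q <= (4 `^ t)%:E * \int[mu]_x g x `^ t.
Proof.
move=> t1 mg g0 ms fs u0 pw ug.
set X := \sum_(Q <- s) _; set G := \int[mu]_x _.
have X0 : 0 <= X by apply: sume_ge0 => Q _; rewrite mule_ge0// lee_fin powR_ge0.
(* Finiteness of [X] allows half of it to be subtracted from both sides of [XG]. *)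
have Xfin : X \is a fin_num.
  rewrite ge0_fin_numE// /X big_seq; apply: lte_sum_pinfty => Q sQ.
  by apply: lte_mul_pinfty; rewrite ?lee_fin ?powR_ge0//; exact: fs.
have G0 : 0 <= G by apply: integral_ge0 => x _; exact: poweR_ge0.
have Phi0 x : (0 <= \sum_(Q <- s) u Q `^ (t - 1) * \1_Q x)%R.
  by apply: sumr_ge0 => Q _; rewrite mulr_ge0 ?powR_ge0.
have Psi0 x : (0 <= \sum_(Q <- s) u Q `^ t * \1_Q x)%R.
  by apply: sumr_ge0 => Q _; rewrite mulr_ge0 ?powR_ge0.
have mPsi : measurable_fun [set: T]
    (fun x => (2^-1 * \sum_(Q <- s) u Q `^ t * \1_Q x)%:E).
  apply/measurable_EFinP; apply: measurable_funM => //.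
  exact: measurable_sum_indic.
have mgt : measurable_fun [set: T] (fun x => (2 * 4 `^ (t - 1))%:E * g x `^ t).
  apply: emeasurable_funM => //.
  exact: measurableT_comp (measurable_poweR t) mg.
have t0 : t != 0%R by rewrite gt_eqF//; lra.
(* Integrated form of [young_doubling]: each [u^t mu(Q) = u^(t-1) (u mu(Q))] is at most the integral
   of [u^(t-1) g] over [Q]. *)
have XG : X <= (2^-1)%:E * X + (2 * 4 `^ (t - 1))%:E * G.
  apply: (@le_trans _ _ (\int[mu]_x
      ((\sum_(Q <- s) u Q `^ (t - 1) * \1_Q x)%:E * g x))).
    rewrite (_ : \int[mu]_x _ = \sum_(Q <- s)
        \int[mu]_x ((u Q `^ (t - 1))%:E * (g x * (\1_Q x)%:E))); last first.
      rewrite -ge0_integral_sum_in.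
      - apply: eq_integral => x _; rewrite -sumEFin ge0_sume_distrl.
          by apply: eq_bigr => Q _; rewrite EFinM -muleA (muleC (g x)).
        by move=> Q _; rewrite lee_fin mulr_ge0 ?powR_ge0.
      - move=> Q sQ; apply: emeasurable_funM; first exact: measurable_cst.
        by apply: measurable_mul_indic => //; exact: ms.
      - by move=> Q sQ x; rewrite !mule_ge0// lee_fin ?powR_ge0.
    rewrite /X big_seq [leRHS]big_seq; apply: lee_sum => Q sQ.
    rewrite ge0_integralZl//; last 3 first.
      - by apply: measurable_mul_indic => //; exact: ms.
      - by move=> x _; rewrite mule_ge0 ?lee_fin.
      - by rewrite lee_fin powR_ge0.
    rewrite integral_mul_indic powR_mulB1 ?u0// mulrC EFinM -muleA.
    rewrite lee_wpmul2l ?lee_fin ?powR_ge0//.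
    exact: ug.
  rewrite /X -integral_sum_indic//; last by move=> Q _; exact: powR_ge0.
  rewrite -ge0_integralZl//; last 2 first.
  - by apply/measurable_EFinP; exact: measurable_sum_indic.
  - by move=> x _; rewrite lee_fin.
  rewrite -ge0_integralZl//; last 2 first.
  - exact: measurableT_comp (measurable_poweR t) mg.
  - by move=> x _; exact: poweR_ge0.
  rewrite -ge0_integralD//; last 2 first.
  - by move=> x _; rewrite mule_ge0 ?lee_fin ?invr_ge0.
  - by move=> x _; rewrite mule_ge0 ?poweR_ge0// lee_fin mulr_ge0 ?powR_ge0.
  apply: ge0_le_integral => //.
  - by move=> x _; rewrite mule_ge0 ?lee_fin.
  - apply: emeasurable_funM => //; apply/measurable_EFinP.
    exact: measurable_sum_indic.
  - exact: emeasurable_funD.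
  move=> x _; move: (g0 x); case: (g x) => [y y0|_|//].
    by rewrite poweR_EFin -!EFinM -EFinD lee_fin young_doubling.
  rewrite poweRyr; last by rewrite gt_eqF//; lra.
  rewrite [X in _ + X]gt0_muley; last by rewrite lte_fin mulr_gt0 ?powR_gt0.
  by rewrite addey ?leey// -EFinM.
have [Gfin|] := boolP (G \is a fin_num); last first.
  rewrite ge0_fin_numE// -leNgt leye_eq => /eqP ->.
  by rewrite gt0_muley ?leey// lte_fin powR_gt0.
(* Subtracting [X / 2] leaves [X <= 4 * 4^(t-1) G = 4^t G]. *)
move: XG; rewrite -(fineK Xfin) -(fineK Gfin) -!EFinM -EFinD !lee_fin.
rewrite (powR_mulB1 _ t0)//; lra.
Qed.

(** * Suprema over cubes *)

Lemma sup_cubes_ubound (R : realType) (d : nat) (D : set (set 'rV[R]_d))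
    (F : set 'rV[R]_d -> \bar R) (Q : set 'rV[R]_d) (x : 'rV[R]_d) :
  D Q -> F Q * (\1_Q x)%:E <= sup_cubes D F x.
Proof. by move=> DQ; apply: ereal_sup_ubound; exists Q. Qed.

Lemma le_sup_cubes (R : realType) (d : nat) (D : set (set 'rV[R]_d))
    (F : set 'rV[R]_d -> \bar R) (Q : set 'rV[R]_d) (x : 'rV[R]_d) :
  D Q -> Q x -> F Q <= sup_cubes D F x.
Proof.
by move=> DQ Qx; have := sup_cubes_ubound F x DQ; rewrite indicE mem_set// mule1.
Qed.

(** The assumption [0 <= M] takes care of the cubes missing [x], whose terms are zero. *)
Lemma sup_cubes_le (R : realType) (d : nat) (D : set (set 'rV[R]_d))
    (F : set 'rV[R]_d -> \bar R) (x : 'rV[R]_d) (M : \bar R) :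
  0 <= M -> (forall Q, D Q -> Q x -> F Q <= M) -> sup_cubes D F x <= M.
Proof.
move=> M0 FM; apply: ge_ereal_sup => _ [Q DQ <-]; rewrite indicE.
have [xQ|_] := boolP (x \in Q); last by rewrite mule0.
by rewrite mule1; apply: FM => //; rewrite inE in xQ.
Qed.

Lemma sup_cubes_ge0 (R : realType) (d : nat) (D : set (set 'rV[R]_d))
    (F : set 'rV[R]_d -> \bar R) (Q : set 'rV[R]_d) (x : 'rV[R]_d) :
  D Q -> 0 <= F Q -> 0 <= sup_cubes D F x.
Proof.
move=> DQ FQ; apply: le_trans (sup_cubes_ubound F x DQ).
by rewrite mule_ge0// lee_fin.
Qed.

Lemma measurable_sup_cubes (R : realType) (d : nat) (D : set (set 'rV[R]_d))
    (F : set 'rV[R]_d -> \bar R) :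
  D `<=` @dyadic R d ->
  measurable_fun [set: borel_space R d] (sup_cubes D F).
Proof.
move=> Dd; have [->|/set0P D0] := eqVneq D set0.
  rewrite (_ : sup_cubes _ _ = cst -oo); first exact: measurable_cst.
  by apply/funext => x; rewrite /sup_cubes image_set0 ereal_sup0.
have cD : countable D.
  exact: sub_countable (subset_card_le Dd) (countable_dyadic R d).
have [e eD] := countable_range cD D0.
rewrite (_ : sup_cubes D F =
    fun x => esups (fun n => F (e n) * (\1_(e n) x)%:E) 0%N).
  apply: measurable_fun_esups => n; apply: measurable_mul_indic => //.
  by apply: measurable_dyadic; apply: Dd; rewrite -eD; exists n.
apply/funext => x; rewrite /sup_cubes /esups/= /sdrop; congr ereal_sup.
apply/seteqP; split=> [_ [Q DQ <-]|_ [n _ <-]].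
  by move: DQ; rewrite -eD => -[n _ <-]; exists n.
by exists (e n) => //; rewrite -eD; exists n.
Qed.

(** Monotone convergence along the first cubes of an enumeration reduces the bound to finite
    families, where [doubling_subfamily] applies. *)
Lemma integral_sup_cubes_le (R : realType) (d : nat)
    (mu : {measure set (borel_space R d) -> \bar R})
    (D : set (set 'rV[R]_d)) (F : set 'rV[R]_d -> \bar R) (K : \bar R) :
  D `<=` @dyadic R d -> D !=set0 -> (forall Q, D Q -> 0 <= F Q) ->
  (forall s : seq (set 'rV[R]_d), [set` s] `<=` D -> s != [::] ->
    \int[mu]_x sup_cubes [set` s] F x <= K) ->
  \int[mu]_x sup_cubes D F x <= K.
Proof.
move=> Dd D0 F0 FK.
have cD : countable D.
  exact: sub_countable (subset_card_le Dd) (countable_dyadic R d).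
have [e eD] := countable_range cD D0.
have De n : D (e n) by rewrite -eD; exists n.
(* Length [n.+1] keeps every list nonempty, so that the finite suprema are nonnegative. *)
pose s n := [seq e i | i <- iota 0 n.+1].
have sD n : [set` s n] `<=` D by move=> _ /mapP[i _ ->].
pose g n := sup_cubes [set` s n] F.
have es i n : (i <= n)%N -> e i \in s n.
  by move=> iln; apply: map_f; rewrite mem_iota.
have g0 n x : 0 <= g n x.
  by apply: (@sup_cubes_ge0 _ _ _ _ (e 0%N)); [exact: es|exact: F0].
have gnd x : {homo g^~ x : n m / (n <= m)%N >-> n <= m}.
  move=> n m nm; apply: sup_cubes_le => // Q /mapP[i].
  rewrite mem_iota add0n ltnS => iln -> ex.
  by apply: le_sup_cubes => //; apply: es; exact: leq_trans nm.
have gE x : sup_cubes D F x = limn (g^~ x).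
  apply/esym/cvg_lim => //.
  rewrite (_ : sup_cubes D F x = ereal_sup (range (g^~ x))).
    exact: ereal_nondecreasing_cvgn.
  apply/eqP; rewrite eq_le; apply/andP; split.
    apply: sup_cubes_le.
      by apply: (le_trans (g0 0%N x)); apply: ereal_sup_ubound; exists 0%N.
    move=> Q; rewrite -eD => -[n _ <-] ex.
    apply: (@le_trans _ _ (g n x)); last by apply: ereal_sup_ubound; exists n.
    by apply: le_sup_cubes => //; exact: es.
  apply: ge_ereal_sup => _ [n _ <-]; apply: sup_cubes_le.
    by apply: (sup_cubes_ge0 _ (De 0%N)); exact: F0.
  by move=> Q Qs Qx; apply: le_sup_cubes => //; exact: (sD n).
under eq_integral do rewrite gE.
have mg n : measurable_fun [set: borel_space R d] (g n).
  by apply: measurable_sup_cubes; exact: subset_trans (sD n) Dd.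
have gcvg := @cvg_monotone_convergence _ _ _ mu _ measurableT g mg
  (fun n x _ => g0 n x) (fun x _ => gnd x).
rewrite -(cvg_lim _ gcvg)//; apply: lime_le.
  by apply/cvg_ex; eexists; exact: gcvg.
by apply: nearW => n; apply: FK => //.
Qed.

Lemma le_poweR (R : realType) (r : R) (a b : \bar R) :
  (0 <= r)%R -> 0 <= a -> a <= b -> a `^ r <= b `^ r.
Proof.
move=> r0 a0 ab; apply: (gt0_ler_poweR r0) => //; rewrite in_itv/= leey andbT//.
exact: le_trans ab.
Qed.

(** On [[0, +oo]] the power [r > 0] is increasing with inverse the power [1/r], so it commutes with
    suprema. *)
Lemma poweR_sup_cubes (R : realType) (d : nat) (D : set (set 'rV[R]_d))
    (F : set 'rV[R]_d -> \bar R) (r : R) (x : 'rV[R]_d) :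
  (0 < r)%R -> D !=set0 -> (forall Q, D Q -> 0 <= F Q) ->
  sup_cubes D F x `^ r = sup_cubes D (fun Q => F Q `^ r) x.
Proof.
move=> r0 [P DP] F0.
have pos : 0 <= sup_cubes D F x by apply: (sup_cubes_ge0 _ DP); exact: F0.
have pos' : 0 <= sup_cubes D (fun Q => F Q `^ r) x.
  by apply: (sup_cubes_ge0 _ DP); exact: poweR_ge0.
apply/eqP; rewrite eq_le; apply/andP; split.
  rewrite -[leRHS]poweRe1// -(mulVf (lt0r_neq0 r0)) poweRrM.
  apply: le_poweR => //; first exact: ltW.
  apply: sup_cubes_le; first exact: poweR_ge0.
  move=> Q DQ Qx; rewrite -[leLHS]poweRe1 ?F0// -(mulfV (lt0r_neq0 r0)) poweRrM.
  apply: le_poweR; rewrite ?poweR_ge0 ?F0//; first by rewrite ltW// invr_gt0.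
  exact: (@le_sup_cubes _ _ _ (fun Q => F Q `^ r)).
apply: sup_cubes_le; first exact: poweR_ge0.
by move=> Q DQ Qx; apply: le_poweR; [exact: ltW|exact: F0|exact: le_sup_cubes].
Qed.

(** * Local suprema *)

(** The function whose average of order [gamma] is [Lambda_sup]. *)
Definition local_sup (R : realType) (d : nat) (lambda : set 'rV[R]_d -> R)
    (Q : set 'rV[R]_d) : 'rV[R]_d -> \bar R :=
  sup_cubes [set S | dyadic S /\ S `<=` Q] (fun S => (lambda S)%:E).

Lemma local_sup_ge0 (R : realType) (d : nat) (lambda : set 'rV[R]_d -> R)
    (Q : set 'rV[R]_d) (x : 'rV[R]_d) :
  (forall S, dyadic S -> 0 <= lambda S)%R -> dyadic Q ->
  0 <= local_sup lambda Q x.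
Proof.
by move=> l0 dQ; apply: (@sup_cubes_ge0 _ _ _ _ Q); [split|rewrite lee_fin l0].
Qed.

Lemma measurable_local_sup (R : realType) (d : nat) (lambda : set 'rV[R]_d -> R)
    (Q : set 'rV[R]_d) :
  measurable_fun [set: borel_space R d] (local_sup lambda Q).
Proof. by apply: measurable_sup_cubes => S []. Qed.

Lemma measurable_local_sup_poweR (R : realType) (d : nat)
    (lambda : set 'rV[R]_d -> R) (Q : set 'rV[R]_d) (r : R) :
  measurable_fun [set: borel_space R d] (fun x => local_sup lambda Q x `^ r).
Proof.
exact: measurableT_comp (measurable_poweR r) (measurable_local_sup lambda Q).
Qed.

(** For a positive exponent [epow] is the usual power, and finiteness of [omega Q] lets the division
    in the average be undone; for [omega Q = 0] both sides vanish. *)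
Lemma Lambda_sup_poweR (R : realType) (d : nat) (lambda : set 'rV[R]_d -> R)
    (omega : {measure set (borel_space R d) -> \bar R}) (r : R)
    (Q : set 'rV[R]_d) :
  (0 < r)%R -> dyadic Q -> omega Q < +oo ->
  Lambda_sup lambda omega r Q `^ r * omega Q =
  \int[omega]_(x in (Q : set (borel_space R d))) local_sup lambda Q x `^ r.
Proof.
move=> r0 dQ fQ; have mQ := measurable_dyadic dQ.
set I := RHS; have I0 : 0 <= I by apply: integral_ge0 => x _; exact: poweR_ge0.
have -> : Lambda_sup lambda omega r Q = (I / omega Q) `^ r^-1.
  rewrite /Lambda_sup /epow ltNge invr_ge0 ltW//= ltNge (ltW r0)/=.
  congr (_ `^ _); rewrite /average; congr (_ / _).
  by apply: eq_integral => x _; rewrite gee0_abs// poweR_ge0.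
rewrite -poweRrM mulVf ?gt_eqF// poweRe1; last first.
  by rewrite mule_ge0// inve_ge0.
have [Q0|Q0] := eqVneq (omega Q) 0.
  rewrite Q0 mule0; apply/esym/null_set_integral => //.
  exact: measurable_funTS (measurable_local_sup_poweR _ _ _).
by rewrite -muleA mulVe ?mule1// ge0_fin_numE.
Qed.

(** * Averages over cubes *)

(** From [|f| <= 1 + |f|^p]. This makes the averages of functions of [L^p(sigma)] over cubes
    finite. *)
Lemma integral_abs_lty d (T : measurableType d) (R : realType)
    (mu : {measure set T -> \bar R}) (f : T -> R) (Q : set T) (p : R) :
  (1 <= p)%R -> measurable Q -> mu Q < +oo -> measurable_fun [set: T] f ->
  \int[mu]_x (`|f x| `^ p)%:E < +oo ->
  \int[mu]_(x in Q) `|f x|%:E < +oo.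
Proof.
move=> p1 mQ fQ mf fp.
have mfp : measurable_fun [set: T] (fun x => (`|f x| `^ p)%:E).
  apply/measurable_EFinP; apply: (measurableT_comp (measurable_powR p)).
  exact: measurableT_comp.
apply: (@le_lt_trans _ _ (\int[mu]_(x in Q) (1 + (`|f x| `^ p)%:E))).
  apply: ge0_le_integral => //.
  - apply: measurable_funTS; apply/measurable_EFinP; exact: measurableT_comp.
  - by apply: measurable_funTS; exact: emeasurable_funD.
  move=> x _; rewrite -EFinD lee_fin.
  have [f1|f1] := leP `|f x|%R 1%R.
    by apply: (le_trans f1); rewrite lerDl powR_ge0.
  rewrite (@le_trans _ _ (`|f x| `^ p)%R)//; last by rewrite lerDr.
  by rewrite -{1}(powRr1 (normr_ge0 (f x))) ler_powR// ltW.
rewrite ge0_integralD//; last exact: measurable_funTS.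
rewrite integral_cst// mul1e lte_add_pinfty//.
apply: le_lt_trans fp; apply: ge0_subset_integral => //.
Qed.

Lemma average_ge0 (R : realType) (d : nat)
    (mu : {measure set (borel_space R d) -> \bar R}) (f : 'rV[R]_d -> \bar R)
    (Q : set 'rV[R]_d) : 0 <= average mu f Q.
Proof. by rewrite mule_ge0 ?inve_ge0 ?integral_ge0. Qed.

Lemma maximal_ge0 (R : realType) (d : nat) (lambda : set 'rV[R]_d -> R)
    (sigma : {measure set (borel_space R d) -> \bar R}) (f : 'rV[R]_d -> R) x :
  (forall Q, dyadic Q -> (0 <= lambda Q)%R) -> 0 <= maximal lambda sigma f x.
Proof.
move=> l0; have [Q dQ] := dyadic_nonempty R d; apply: (sup_cubes_ge0 _ dQ).
by rewrite mule_ge0 ?average_ge0// lee_fin l0.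
Qed.

Lemma average_mul (R : realType) (d : nat)
    (mu : {measure set (borel_space R d) -> \bar R}) (f : 'rV[R]_d -> \bar R)
    (Q : set 'rV[R]_d) :
  measurable_fun [set: borel_space R d] f -> dyadic Q -> mu Q < +oo ->
  average mu f Q * mu Q = \int[mu]_(x in (Q : set (borel_space R d))) `|f x|.
Proof.
move=> mf dQ fQ; have mQ := measurable_dyadic dQ; rewrite /average.
have [Q0|Q0] := eqVneq (mu Q) 0.
  rewrite Q0 mule0; apply/esym/null_set_integral => //.
  by apply: measurable_funTS; exact: measurableT_comp.
by rewrite -muleA mulVe ?mule1// ge0_fin_numE.
Qed.

Lemma average0 (R : realType) (d : nat)
    (mu : {measure set (borel_space R d) -> \bar R}) (f : 'rV[R]_d -> \bar R)
    (Q : set 'rV[R]_d) :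
  measurable_fun [set: borel_space R d] f -> dyadic Q -> mu Q = 0 ->
  average mu f Q = 0.
Proof.
move=> mf dQ Q0; rewrite /average null_set_integral ?mul0e//.
  exact: measurable_dyadic.
by apply: measurable_funTS; exact: measurableT_comp.
Qed.

Lemma average_fin_num (R : realType) (d : nat)
    (mu : {measure set (borel_space R d) -> \bar R}) (f : 'rV[R]_d -> \bar R)
    (Q : set 'rV[R]_d) :
  measurable_fun [set: borel_space R d] f -> dyadic Q ->
  \int[mu]_(x in (Q : set (borel_space R d))) `|f x| < +oo ->
  average mu f Q \is a fin_num.
Proof.
move=> mf dQ fQ; have [Q0|Q0] := eqVneq (mu Q) 0; first by rewrite average0.
have I0 : 0 <= \int[mu]_(x in (Q : set (borel_space R d))) `|f x|.
  exact: integral_ge0.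
have muQ : 0 <= mu Q by [].
rewrite /average fin_numM ?ge0_fin_numE// ?inve_ge0//.
move: Q0 muQ; case: (mu Q) => [r|_ _|//]; rewrite /inve/=; last exact: ltry.
by rewrite eqe => /negPf -> _; exact: ltry.
Qed.

Lemma le_local_sup (R : realType) (d : nat) (lambda : set 'rV[R]_d -> R)
    (Q P : set 'rV[R]_d) (x : 'rV[R]_d) :
  dyadic Q -> Q `<=` P -> Q x -> (lambda Q)%:E <= local_sup lambda P x.
Proof. by move=> dQ QP Qx; apply: le_sup_cubes. Qed.

(* The summand of the sufficient condition is
   [lambda Q `^ q * (I / sigma Q) `^ (q / (p - q))], where [I] is the integral
   over [Q] of [local_sup lambda Q `^ q]. *)
Lemma heavy_cube_bound (R : realType) (d : nat)
    (lambda : set 'rV[R]_d -> R)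
    (sigma omega : {measure set (borel_space R d) -> \bar R}) (p q delta v : R)
    (Q : set 'rV[R]_d) :
  (0 < q)%R -> (q < p)%R -> (0 < delta)%R -> (0 <= v)%R -> (0 <= lambda Q)%R ->
  dyadic Q -> omega Q < +oo -> sigma Q < +oo -> 0 < sigma Q ->
  (delta * v `^ (p - q))%:E * sigma Q <=
    \int[omega]_(x in (Q : set (borel_space R d))) local_sup lambda Q x `^ q ->
  ((lambda Q * v) `^ q)%:E <= (delta `^ (- (q / (p - q))))%:E *
    ((omega Q / sigma Q) `^ (q / (p - q)) * (lambda Q `^ q)%:E *
     Lambda_sup lambda omega q Q `^ (q ^+ 2 / (p - q))).
Proof.
move=> q0 qp delta0 v0 l0 dQ fo fs s0; set a := (q / (p - q))%R.
have pq0 : (0 < p - q)%R by rewrite subr_gt0.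
have a0 : (0 <= a)%R by rewrite divr_ge0// ltW.
(* The power [q^2/(p-q)] of [Lambda] is [(Lambda^q)^a], and [omega(Q) Lambda^q] is the integral in
   the hypothesis. *)
rewrite -Lambda_sup_poweR// expr2 -mulrA -/a poweRrM.
set L := Lambda_sup _ _ _ _ `^ q; have L0 : 0 <= L by exact: poweR_ge0.
have is0 : 0 <= (sigma Q)^-1 by rewrite inve_ge0.
move=> heavy; rewrite [X in _ * X]muleAC -poweRM ?mule_ge0//.
have t_ge : (delta * v `^ (p - q))%:E <= omega Q / sigma Q * L.
  have sfin : sigma Q \is a fin_num by rewrite ge0_fin_numE// ltW.
  rewrite -[leLHS]mule1 -(@mulVe _ (sigma Q)) ?gt_eqF// muleCA.
  rewrite -(muleC (sigma Q)^-1) -muleA lee_wpmul2l// muleC (muleC (omega Q)).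
  by rewrite muleC.
have dv0 : (0 <= delta * v `^ (p - q))%R by rewrite mulr_ge0 ?powR_ge0// ltW.
(* Since [(p-q) a = q], raising the lower bound to the power [a] produces [delta^a v^q]. *)
have : ((delta `^ a)%R * (v `^ q)%R)%:E <= (omega Q / sigma Q * L) `^ a.
  have -> : ((delta `^ a)%R * (v `^ q)%R)%:E = (delta * v `^ (p - q))%:E `^ a.
    rewrite poweR_EFin powRM ?powR_ge0 ?(ltW delta0)// -powRrM.
    by congr (_ * _ `^ _)%:E; rewrite /a mulrC divfK// gt_eqF.
  by apply: le_poweR; rewrite ?lee_fin.
have dl0 : 0 <= (delta `^ (- a) * lambda Q `^ q)%:E.
  by rewrite lee_fin mulr_ge0 ?powR_ge0.
move=> /(lee_wpmul2l dl0); congr (_ <= _); last first.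
  by rewrite EFinM -!muleA; congr (_ * _); rewrite muleC.
rewrite -EFinM powRM//; congr EFin.
rewrite mulrACA -powRD ?addNr ?powRr0 ?mul1r//.
by apply/implyP => _; rewrite gt_eqF.
Qed.

(** * Sufficient condition *)

(** Raise both sides to the power [r/t]. This converts the comparison of weights from
    [doubling_subfamily] to another exponent. *)
Lemma ge0_powR_mono (R : realType) (a b r t : R) :
  (0 < t)%R -> (0 <= r)%R -> (0 <= a)%R -> (0 <= b)%R ->
  (a `^ t <= 2 * b `^ t)%R -> (a `^ r <= 2 `^ (r / t) * b `^ r)%R.
Proof.
move=> t0 r0 a0 b0 ab; have rt : (0 <= r / t)%R by rewrite divr_ge0// ltW.
have pE c : (0 <= c -> c `^ r = (c `^ t) `^ (r / t))%R.
  by move=> c0; rewrite -powRrM mulrC divfK// gt_eqF.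
rewrite pE// (pE b)// -powRM ?powR_ge0//.
by apply: ge0_ler_powR => //; rewrite nnegrE ?mulr_ge0// powR_ge0.
Qed.

(** The bound at a fixed threshold [delta] for a finite family. Pointwise, a heavy cube is
    controlled by the supremum in the condition and a light one by the term [h P] of a selected
    cube; the integrals of the [h P] are summed by [carleson_embedding]. *)
Lemma integral_maximal_le (R : realType) (d : nat)
    (lambda : set 'rV[R]_d -> R)
    (sigma omega : {measure set (borel_space R d) -> \bar R}) (p q delta : R)
    (f : borel_space R d -> R) (s : seq (set 'rV[R]_d)) :
  (1 < p)%R -> (0 < q)%R -> (q < p)%R -> (0 < delta)%R ->
  locally_finite sigma -> locally_finite omega ->
  (forall Q, dyadic Q -> 0 <= lambda Q)%R ->
  measurable_fun [set: borel_space R d] f ->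
  \int[sigma]_x (`|f x| `^ p)%:E < +oo ->
  [set` s] `<=` @dyadic R d -> s != [::] ->
  \int[omega]_x sup_cubes [set` s]
    (fun Q => ((lambda Q)%:E * average sigma (EFin \o f) Q) `^ q) x <=
  (delta `^ (- (q / (p - q))))%:E *
    (\int[omega]_x sup_cubes (@dyadic R d)
       (fun Q => (omega Q / sigma Q) `^ (q / (p - q)) * (lambda Q `^ q)%:E *
                 Lambda_sup lambda omega q Q `^ (q ^+ 2 / (p - q))) x) +
  (2 `^ (q / (p - 1)) * 4 `^ p * delta)%:E * \int[sigma]_x (`|f x| `^ p)%:E.
Proof.
move=> p1 q0 qp d0 lfs lfo l0 mf fp sd sn0.
have p10 : (0 < p - 1)%R by rewrite subr_gt0.
have mEf : measurable_fun [set: borel_space R d] (EFin \o f).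
  exact/measurable_EFinP.
have fsig Q : dyadic Q -> sigma Q < +oo by exact: locally_finite_dyadic.
have fom Q : dyadic Q -> omega Q < +oo by exact: locally_finite_dyadic.
pose I Q := \int[omega]_(x in (Q : set (borel_space R d)))
  local_sup lambda Q x `^ q.
pose v Q := fine (average sigma (EFin \o f) Q).
have v0 Q : (0 <= v Q)%R by apply: fine_ge0; exact: average_ge0.
have vE Q : dyadic Q -> average sigma (EFin \o f) Q = (v Q)%:E.
  move=> dQ; rewrite fineK//; apply: average_fin_num => //=.
  by apply: integral_abs_lty fp; [exact: ltW|exact: measurable_dyadic|exact: fsig|].
have vI Q : dyadic Q -> (v Q)%:E * sigma Q =
    \int[sigma]_(x in (Q : set (borel_space R d))) `|f x|%:E.
  by move=> dQ; rewrite -vE// average_mul// fsig.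
pose light := [seq Q <- s | I Q <= (delta * v Q `^ (p - q))%:E * sigma Q].
have ls Q : Q \in light -> dyadic Q.
  by rewrite mem_filter => /andP[_ Qs]; exact: sd.
(* The weight [v^(p-1)] is the one that [carleson_embedding] requires at exponent [p]. *)
have [||s0 [s0l cov pw]] :=
  @doubling_subfamily R _ (fun Q => v Q `^ (p - 1))%R light.
- by move=> Q _; exact: powR_ge0.
- by move=> P Q Pl Ql; apply: dyadic_nested; exact: ls.
have s0d Q : Q \in s0 -> dyadic Q by move=> /s0l/ls.
(* The loss in passing from [v_Q^(p-1) <= 2 v_P^(p-1)] to powers of order [q]. *)
pose c := (2 `^ (q / (p - 1)))%R : R.
pose F Q := (omega Q / sigma Q) `^ (q / (p - q)) * (lambda Q `^ q)%:E *
            Lambda_sup lambda omega q Q `^ (q ^+ 2 / (p - q)).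
have F0 Q : 0 <= F Q by rewrite !mule_ge0 ?poweR_ge0// lee_fin powR_ge0.
have W0 x : 0 <= sup_cubes (@dyadic R d) F x.
  by have [Q dQ] := dyadic_nonempty R d; exact: sup_cubes_ge0 dQ (F0 _).
pose h P x := (c * v P `^ q)%:E * (local_sup lambda P x `^ q * (\1_P x)%:E).
have c0 : (0 <= c)%R by exact: powR_ge0.
have h0 P x : 0 <= h P x.
  by rewrite !mule_ge0 ?poweR_ge0// lee_fin// mulr_ge0 ?powR_ge0.
have D0 : 0 <= (delta `^ (- (q / (p - q))))%:E by rewrite lee_fin powR_ge0.
have mh P : P \in s0 -> measurable_fun [set: borel_space R d] (h P).
  move=> Ps; apply: emeasurable_funM => //; apply: measurable_mul_indic.
    exact: measurable_local_sup_poweR.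
  by apply: measurable_dyadic; exact: s0d.
have mW : measurable_fun [set: borel_space R d] (sup_cubes (@dyadic R d) F).
  exact: measurable_sup_cubes.
have mS : measurable_fun [set: borel_space R d]
    (fun x => \sum_(P <- s0) h P x).
  exact: emeasurable_sum_in.
have pointwise x : sup_cubes [set` s]
    (fun Q => ((lambda Q)%:E * average sigma (EFin \o f) Q) `^ q) x <=
    (delta `^ (- (q / (p - q))))%:E * sup_cubes (@dyadic R d) F x +
    \sum_(P <- s0) h P x.
  have S0 : 0 <= \sum_(P <- s0) h P x by exact: sume_ge0.
  apply: sup_cubes_le; first by rewrite adde_ge0// mule_ge0.
  move=> Q Qs Qx; have dQ := sd _ Qs; rewrite vE// -EFinM poweR_EFin.
  have [Ql|] := boolP (Q \in light).
    have [P Ps [QP vQP]] := cov _ Ql.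
    rewrite -[leLHS]add0e leeD ?mule_ge0//.
    rewrite (big_rem P)//= -[leLHS]adde0 leeD//; last exact: sume_ge0.
    rewrite /h indicE mem_set; last exact: QP.
    rewrite mule1 powRM ?l0// mulrC EFinM lee_pmul ?lee_fin ?powR_ge0//.
      by apply: (@ge0_powR_mono _ _ _ _ (p - 1)) => //; exact: ltW.
    rewrite -poweR_EFin; apply: le_poweR; [exact: ltW|by rewrite lee_fin l0|].
    exact: le_local_sup.
  rewrite mem_filter Qs andbT -ltNge => heavy.
  rewrite -[leLHS]adde0 leeD//.
  (* A nonzero average forces [sigma Q > 0], as [heavy_cube_bound] requires. *)
  have [v00|vn0] := eqVneq (v Q) 0%R.
    by rewrite v00 mulr0 powR0 ?gt_eqF// mule_ge0.
  apply: (le_trans (heavy_cube_bound q0 qp d0 (v0 Q) (l0 _ dQ) dQ (fom _ dQ)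
    (fsig _ dQ) _ (ltW heavy))).
    rewrite lt0e measure_ge0 andbT; apply/eqP => sQ.
    by move/eqP: vn0; apply; rewrite /v average0.
  by rewrite lee_wpmul2l// /F; apply: le_sup_cubes.
apply: (@le_trans _ _ (\int[omega]_x
    ((delta `^ (- (q / (p - q))))%:E * sup_cubes (@dyadic R d) F x +
     \sum_(P <- s0) h P x))).
  apply: ge0_le_integral => //.
  - move=> x _; case: s sn0 {sd light ls s0l cov pointwise} => // Q s _.
    by apply: (@sup_cubes_ge0 _ _ _ _ Q); [exact: mem_head|exact: poweR_ge0].
  - exact: measurable_sup_cubes.
  - by apply: emeasurable_funD => //; exact: emeasurable_funM.
rewrite ge0_integralD//; last 3 first.
- by move=> x _; rewrite mule_ge0.
- exact: emeasurable_funM.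
- by move=> x _; exact: sume_ge0.
rewrite ge0_integralZl// leeD//.
rewrite ge0_integral_sum_in//.
apply: (@le_trans _ _ (\sum_(P <- s0) (c * delta)%:E * ((v P `^ p)%:E * sigma P))).
  rewrite big_seq [leRHS]big_seq; apply: lee_sum => P Ps; have dP := s0d _ Ps.
  have mP := measurable_dyadic dP.
  rewrite /h ge0_integralZl//; last 3 first.
  - by apply: measurable_mul_indic => //; exact: measurable_local_sup_poweR.
  - by move=> x _; rewrite mule_ge0 ?poweR_ge0// lee_fin.
  - by rewrite lee_fin mulr_ge0 ?powR_ge0.
  rewrite integral_mul_indic.
  (* Selected cubes are light, so [v_P^q I_P <= delta v_P^p sigma(P)]. *)
  have : I P <= (delta * v P `^ (p - q))%:E * sigma P.
    by have := s0l _ Ps; rewrite mem_filter => /andP[].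
  have cv0 : 0 <= (c * v P `^ q)%:E by rewrite lee_fin mulr_ge0 ?powR_ge0.
  move=> /(lee_wpmul2l cv0) /le_trans; apply.
  rewrite !muleA -!EFinM; apply: lee_wpmul2r => //; rewrite lee_fin.
  rewrite mulrACA -powRD; last by apply/implyP => /eqP; lra.
  by rewrite (addrC q) subrK.
rewrite -ge0_sume_distrr; last by move=> P _; rewrite mule_ge0 ?lee_fin ?powR_ge0.
rewrite -/c (mulrAC c) [(_ * 4 `^ p)%:E]EFinM -[leRHS]muleA lee_wpmul2l//.
  by rewrite lee_fin mulr_ge0// ltW.
have := @carleson_embedding _ (borel_space R d) R sigma p v s0
  (fun x => `|f x|%:E) p1.
under [X in _ -> _ -> _ -> _ -> _ -> _ -> _ -> _ <= _ * X]eq_integral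
  do rewrite poweR_EFin.
apply=> //.
- by apply/measurable_EFinP; exact: measurableT_comp.
- by move=> P Ps; apply: measurable_dyadic; exact: s0d.
- by move=> P Ps; apply: fsig; exact: s0d.
- by move=> P Ps; rewrite vI//; exact: s0d.
Qed.

(** The choice [delta = (B/N)^((p-q)/p)] makes both [delta^(-q/(p-q)) B] and [delta N] equal to
    [B^((p-q)/p) N^(q/p)]. If [B] vanishes a small [delta], and if [N] vanishes a large one, brings
    the bound down to any [e > 0]. *)
Lemma optimize_delta (R : realType) (p q K B N : R) (X : \bar R) :
  (0 < q)%R -> (q < p)%R -> (0 < K)%R -> (0 <= B)%R -> (0 <= N)%R ->
  (forall delta, (0 < delta)%R ->
     X <= (delta `^ (- (q / (p - q))) * B + K * delta * N)%:E) ->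
  X <= ((1 + K) * B `^ ((p - q) / p) * N `^ (q / p))%:E.
Proof.
move=> q0 qp K0 B0 N0 HX.
have pq0 : (0 < p - q)%R by rewrite subr_gt0.
have p0 : (0 < p)%R by exact: lt_trans qp.
have pn0 : p != 0%R by rewrite gt_eqF.
have pqn0 : (p - q)%R != 0%R by rewrite gt_eqF.
have [B00|Bn0] := eqVneq B 0%R.
  rewrite B00 powR0 ?mulr0 ?mul0r; last by rewrite gt_eqF// divr_gt0.
  apply/lee_addgt0Pr => e e0; rewrite add0e.
  have KN : (0 < K * (N + 1))%R by rewrite mulr_gt0// ltr_wpDl.
  (* [N + 1] avoids division by zero; the bound becomes [e N / (N + 1)]. *)
  apply: (le_trans (HX (e / (K * (N + 1)))%R _)); first by rewrite divr_gt0.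
  have N1 : (0 < N + 1)%R by rewrite ltr_wpDl.
  have -> : (K * (e / (K * (N + 1))) * N = e * (N / (N + 1)))%R.
    by field; rewrite !gt_eqF.
  rewrite lee_fin B00 mulr0 add0r ler_piMr ?(ltW e0)//.
  by rewrite ler_pdivrMr// mul1r lerDl.
have Bp : (0 < B)%R by rewrite lt0r Bn0.
have [N00|Nn0] := eqVneq N 0%R.
  rewrite N00 powR0 ?mulr0; last by rewrite gt_eqF// divr_gt0.
  apply/lee_addgt0Pr => e e0; rewrite add0e.
  apply: (le_trans (HX ((e / B) `^ (- ((p - q) / q)))%R _)).
    by rewrite powR_gt0// divr_gt0.
  rewrite lee_fin N00 mulr0 addr0 -powRrM mulrNN -[(q / (p - q))%R]invf_div.
  by rewrite mulfV ?mulf_neq0 ?invr_neq0 ?gt_eqF// powRr1 ?divfK// divr_ge0 ?ltW.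
have Np : (0 < N)%R by rewrite lt0r Nn0.
apply: (le_trans (HX ((B / N) `^ ((p - q) / p))%R _)).
  by rewrite powR_gt0// divr_gt0.
have E1 : (q / p = 1 - (p - q) / p)%R by field.
have E2 : ((p - q) / p = 1 - q / p)%R by field.
have powB (x r : R) : (0 < x)%R -> (x `^ (1 - r) = x * x `^ (- r))%R.
  move=> x0; rewrite powRD; last by apply/implyP => _; rewrite gt_eqF.
  by rewrite powRr1// ltW.
have powV (x r : R) : (0 < x)%R -> ((x^-1) `^ r = x `^ (- r))%R.
  by move=> x0; rewrite -powR_inv1 ?ltW// -powRrM mulN1r.
rewrite lee_fin -powRrM.
have -> : ((p - q) / p * (- (q / (p - q))) = - (q / p))%R by field; rewrite pn0.
rewrite !powRM ?invr_ge0// !powV// opprK.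
have eB : (B `^ ((p - q) / p) = B * B `^ (- (q / p)))%R by rewrite E2 powB.
have eN : (N `^ (q / p) = N * N `^ (- ((p - q) / p)))%R by rewrite {1}E1 powB.
by rewrite eB eN le_eqVlt; apply/orP; left; apply/eqP; ring.
Qed.

Lemma sufficient_condition (R : realType) (p q : R) :
  (1 < p)%R -> (0 < q)%R -> (q < p)%R ->
  exists c : R, (0 < c)%R /\
    forall (d : nat) (sigma omega : {measure set (borel_space R d) -> \bar R})
      (lambda : set 'rV[R]_d -> R),
      locally_finite sigma -> locally_finite omega ->
      (forall Q, dyadic Q -> 0 <= lambda Q)%R ->
      maximal_norm lambda sigma omega p q
       <= c%:E *
          (\int[omega]_x
             sup_cubes (@dyadic R d)
               (fun Q => (omega Q / sigma Q) `^ (q / (p - q))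
                         * (lambda Q `^ q)%:E
                         * Lambda_sup lambda omega q Q
                             `^ (q ^+ 2 / (p - q))) x)
          `^ ((p - q) / (p * q)).
Proof.
move=> p1 q0 qp.
have p0 : (0 < p)%R by exact: lt_trans qp.
have pq0 : (0 < p - q)%R by rewrite subr_gt0.
pose K : R := (2 `^ (q / (p - 1)) * 4 `^ p)%R.
have K0 : (0 < K)%R by rewrite mulr_gt0 ?powR_gt0.
(* [K] is the factor of [delta] in [integral_maximal_le]; [optimize_delta] turns it into [1 + K],
   and the [q]-th root is taken at the end. *)
exists ((1 + K) `^ q^-1)%R; split; first by rewrite powR_gt0 ?addr_gt0.
move=> d sigma omega lambda lfs lfo l0.
set B := \int[omega]_x _.
have B0 : 0 <= B.
  apply: integral_ge0 => x _; have [Q dQ] := dyadic_nonempty R d.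
  by apply: (sup_cubes_ge0 _ dQ); rewrite !mule_ge0 ?poweR_ge0// lee_fin powR_ge0.
have [Bfin|] := boolP (B \is a fin_num); last first.
  rewrite ge0_fin_numE// -leNgt leye_eq => /eqP ->.
  rewrite poweRyr; last by rewrite gt_eqF// divr_gt0// mulr_gt0.
  by rewrite gt0_muley ?leey// lte_fin powR_gt0 ?addr_gt0.
apply: ereal_inf_lbound.
exists ((1 + K) `^ q^-1 * fine B `^ ((p - q) / (p * q)))%R; last first.
  by rewrite EFinM; congr (_ * _); rewrite -poweR_EFin fineK.
split=> [|f /andP[]]; first by rewrite mulr_ge0 ?powR_ge0.
rewrite !inE /= => mf; rewrite /finite_norm => Nfin.
have NE : 'N[sigma]_p%:E[EFin \o f] =
    (\int[sigma]_x (`|f x| `^ p)%:E) `^ p^-1 by rewrite unlock.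
set N := \int[sigma]_x (`|f x| `^ p)%:E in NE.
have N0 : 0 <= N by apply: integral_ge0 => x _; rewrite lee_fin powR_ge0.
have Nlty : N < +oo.
  by apply: (@lty_poweRy _ _ p^-1); rewrite -?NE// invr_neq0// gt_eqF.
have Nf : N \is a fin_num by rewrite ge0_fin_numE.
have X_le : \int[omega]_x maximal lambda sigma f x `^ q <=
    ((1 + K) * fine B `^ ((p - q) / p) * fine N `^ (q / p))%:E.
  apply: optimize_delta => // [||delta d0]; [exact: fine_ge0|exact: fine_ge0|].
  rewrite (_ : \int[omega]_x _ = \int[omega]_x sup_cubes (@dyadic R d)
      (fun Q => ((lambda Q)%:E * average sigma (EFin \o f) Q) `^ q) x); last first.
    apply: eq_integral => x _; apply: poweR_sup_cubes => //.
      exact: dyadic_nonempty.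
    by move=> Q dQ; rewrite mule_ge0 ?average_ge0// lee_fin l0.
  rewrite EFinD !EFinM !fineK -?EFinM//.
  apply: integral_sup_cubes_le => //; [exact: dyadic_nonempty| |].
  - by move=> Q _; exact: poweR_ge0.
  by move=> s sd sn0; exact: integral_maximal_le.
rewrite NE -(fineK Nf) poweR_EFin unlock.
have -> : \int[omega]_x `|maximal lambda sigma f x| `^ q =
    \int[omega]_x maximal lambda sigma f x `^ q.
  by apply: eq_integral => x _; rewrite gee0_abs// maximal_ge0.
apply: (@le_trans _ _
    (((1 + K) * fine B `^ ((p - q) / p) * fine N `^ (q / p))%:E `^ q^-1)).
  apply: le_poweR => //; first by rewrite invr_ge0 ltW.
  by apply: integral_ge0 => x _; exact: poweR_ge0.
have K1 : (0 <= 1 + K)%R by rewrite addr_ge0// ltW.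
rewrite poweR_EFin -EFinM lee_fin !powRM ?mulr_ge0 ?powR_ge0// -!powRrM.
have -> : ((p - q) / p * q^-1 = (p - q) / (p * q))%R.
  by field; rewrite !gt_eqF.
by have -> : (q / p * q^-1 = p^-1)%R by field; rewrite !gt_eqF.
Qed.

(** * Necessary condition *)

Lemma measurable_inve d (T : measurableType d) (R : realType)
    (f : T -> \bar R) :
  measurable_fun [set: T] f -> (forall x, 0 <= f x) ->
  measurable_fun [set: T] (fun x => (f x)^-1).
Proof.
(* At [f x = +oo] the formula is still right: [fine] gives 0, and the real power [-1] of 0 is 0. *)
move=> mf f0; rewrite (_ : (fun x => _) = fun x =>
    if f x == 0 then +oo else (fine (f x) `^ (- 1))%:E).
  apply: measurable_fun_ifT => //=; first exact: measurable_fun_eqe.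
  apply/measurable_EFinP; apply: (measurableT_comp (measurable_powR _)) => //.
  exact: measurableT_comp.
apply/funext => x; move: (f0 x); case: (f x) => [r|_|//].
  by rewrite lee_fin => r0; rewrite /inve eqe/= powR_inv1.
by rewrite /inve/= powR0// oppr_eq0 oner_eq0.
Qed.

(** If [y^a >= t] the second term suffices; otherwise [y^b <= t^(b/a)] and the first does. *)
Lemma inv_poweR_ge (R : realType) (a b t : R) (y : \bar R) :
  (0 < a)%R -> (0 < b)%R -> (0 < t)%R -> 0 <= y ->
  (t `^ (- (b / a)))%:E <=
    (y `^ b)^-1 + (t `^ (- (b / a)) * t^-1)%:E * y `^ a.
Proof.
move=> a0 b0 t0; have ba0 : (0 < b / a)%R by exact: divr_gt0.
have T0 : (0 < t `^ (- (b / a)))%R by rewrite powR_gt0.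
have Tt0 : (0 < t `^ (- (b / a)) * t^-1)%R by rewrite mulr_gt0 ?invr_gt0.
case: y => [y|_|//]; last first.
  by rewrite !poweRyr ?gt_eqF// gt0_muley ?lte_fin// addey ?leey// /inve.
rewrite lee_fin => y0; rewrite !poweR_EFin.
have [ty|yt] := leP t (y `^ a)%R.
  rewrite -[leLHS]add0e leeD//; first by rewrite inve_ge0 lee_fin powR_ge0.
  by rewrite -EFinM lee_fin -mulrA ler_peMr ?(ltW T0)// ler_pdivlMl// mulr1.
rewrite -[leLHS]adde0 leeD//; last first.
  by rewrite -EFinM lee_fin mulr_ge0 ?powR_ge0// ltW.
rewrite /inve; case: ifPn => [_|yb0]; first exact: leey.
have yb : (0 < y `^ b)%R by rewrite lt0r yb0 powR_ge0.
have tb : (0 < t `^ (b / a))%R by rewrite powR_gt0.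
rewrite lee_fin powRN lef_pV2 ?posrE//.
have -> : (y `^ b = (y `^ a) `^ (b / a))%R by rewrite -powRrM mulrC divfK ?gt_eqF.
by apply: ge0_ler_powR; rewrite ?nnegrE ?powR_ge0//; exact: ltW.
Qed.

(* Jensen's inequality up to the constant [kappa], obtained by comparing with
   the constant function [2 * average]. *)
Lemma Lambda_sup_le (R : realType) (q r : R) :
  (0 < q)%R -> (r < q)%R -> r != 0%R ->
  exists a kappa : R, [/\ (0 < a < q)%R, (0 < kappa)%R &
    forall (d : nat) (omega : {measure set (borel_space R d) -> \bar R})
      (lambda : set 'rV[R]_d -> R) (Q : set 'rV[R]_d),
      (forall S, dyadic S -> 0 <= lambda S)%R -> dyadic Q -> omega Q < +oo ->
      kappa%:E * Lambda_sup lambda omega r Q `^ a * omega Q <=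
      \int[omega]_(x in (Q : set (borel_space R d))) local_sup lambda Q x `^ a].
Proof.
move=> q0 rq rn0; have [r0|r0] := leP 0%R r.
  have rp : (0 < r)%R by rewrite lt0r rn0.
  exists r, 1%R; split=> // [|d omega lambda Q l0 dQ fQ]; first by rewrite rp.
  by rewrite mul1e Lambda_sup_poweR.
(* For [r < 0] the value [q/2] is an arbitrary choice in [(0, q)]. *)
pose a := (q / 2)%R; have a0 : (0 < a)%R by rewrite divr_gt0.
pose b := (- r)%R; have b0 : (0 < b)%R by rewrite oppr_gt0.
exists a, (2^-1 * 2 `^ (- (a / b)))%R; split.
- by rewrite a0 /a; lra.
- by rewrite mulr_gt0 ?powR_gt0.
move=> d omega lambda Q l0 dQ fQ; have mQ := measurable_dyadic dQ.
set I := (X in _ <= X); have I0 : 0 <= I.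
  by apply: integral_ge0 => x _; exact: poweR_ge0.
have [Q0|Q0] := eqVneq (omega Q) 0; first by rewrite Q0 mule0.
have [Ifin|] := boolP (I \is a fin_num); last first.
  by rewrite ge0_fin_numE// -leNgt leye_eq => /eqP ->; exact: leey.
pose W := fine (omega Q).
have WE : omega Q = W%:E by rewrite fineK// ge0_fin_numE.
have W0 : (0 < W)%R by rewrite -lte_fin -WE lt0e Q0 measure_ge0.
set L := Lambda_sup lambda omega r Q.
pose h x := (local_sup lambda Q x `^ b)^-1.
have h0 x : 0 <= h x by rewrite inve_ge0 poweR_ge0.
have mh : measurable_fun [set: borel_space R d] h.
  apply: measurable_inve; first exact: measurable_local_sup_poweR.
  by move=> x; exact: poweR_ge0.
pose A := (\int[omega]_(x in (Q : set (borel_space R d))) h x) / omega Q.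
have LE : L = (A `^ b^-1)^-1.
  rewrite /L /Lambda_sup /epow invr_lt0 r0 -invrN; congr ((_ `^ _)^-1).
  rewrite /average /A; congr (_ / _).
  apply: eq_integral => x _; rewrite gee0_abs//; exact: h0.
(* Write [m] for [local_sup lambda Q]. If [t] is at least twice the average of [m^a], the last term
   of [inv_poweR_ge] integrates to at most half of the left side. So [m^(-b)] has average at least
   half of [t^(-b/a)], which bounds [L] from above. *)
have L_le t : (0 < t)%R -> I <= (2^-1 * t * W)%:E -> L `^ a <= (2 `^ (a / b) * t)%:E.
  move=> t0 It; pose T : R := (t `^ (- (b / a)))%R.
  have T0 : (0 < T)%R by rewrite powR_gt0.
  have TA : (2^-1 * T)%:E <= A.
    have : (T * W)%:E <= A * omega Q + (T * t^-1)%:E * I.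
      rewrite /A -muleA mulVe ?mule1//; last by rewrite WE.
      rewrite -ge0_integralZl//; last 3 first.
      - exact: measurable_funTS (measurable_local_sup_poweR _ _ _).
      - by move=> x _; exact: poweR_ge0.
      - by rewrite lee_fin ltW// mulr_gt0 ?invr_gt0.
      rewrite -ge0_integralD//; last 3 first.
      - exact: measurable_funTS.
      - move=> x _; rewrite mule_ge0 ?poweR_ge0//.
        by rewrite lee_fin ltW// mulr_gt0 ?invr_gt0.
      - apply: emeasurable_funM => //.
        exact: measurable_funTS (measurable_local_sup_poweR _ _ _).
      rewrite EFinM -WE -integral_cst//; apply: ge0_le_integral => //.
      - by move=> x _; rewrite lee_fin ltW.
      - apply: emeasurable_funD; first exact: measurable_funTS.
        apply: emeasurable_funM => //.
        exact: measurable_funTS (measurable_local_sup_poweR _ _ _).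
      move=> x _; apply: inv_poweR_ge => //; exact: local_sup_ge0.
    have A0 : 0 <= A by rewrite mule_ge0 ?inve_ge0 ?integral_ge0.
    rewrite WE; move: A0; case: (A) => [A'|_ _|//]; last exact: leey.
    rewrite -(fineK Ifin) in It *; rewrite -!EFinM -EFinD !lee_fin => A0 TW.
    have : (T * t^-1 * fine I <= T * t^-1 * (2^-1 * t * W))%R.
      by rewrite ler_wpM2l// ltW// mulr_gt0 ?invr_gt0.
    have -> : (T * t^-1 * (2^-1 * t * W) = 2^-1 * T * W)%R.
      by field; rewrite gt_eqF.
    move=> IW; rewrite -(ler_pM2r W0); lra.
  have T2 : (0 < 2^-1 * T)%R by rewrite mulr_gt0.
  have -> : (2 `^ (a / b) * t)%:E = ((2^-1 * T)%:E `^ b^-1)^-1 `^ a.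
    rewrite poweR_EFin /inve gt_eqF ?powR_gt0// poweR_EFin; congr EFin.
    rewrite -powRN -powRrM powRM ?(ltW T0)//; congr (_ * _)%R.
      rewrite -(@powR_inv1 _ 2%R)// -powRrM; congr powR.
      by field; rewrite gt_eqF.
    rewrite /T -powRrM.
    have -> : (- (b / a) * (- b^-1 * a) = 1)%R by field; rewrite !gt_eqF.
    by rewrite powRr1// ltW.
  rewrite LE; apply: le_poweR; [exact: ltW|by rewrite inve_ge0 poweR_ge0|].
  rewrite lee_pV2 ?inE ?poweR_ge0//; apply: le_poweR => //.
    by rewrite invr_ge0 ltW.
  by rewrite lee_fin ltW.
(* Adding [e] keeps the level [t] positive when [I] is zero. *)
apply/lee_addgt0Pr => e e0.
have Ie0 : (0 < fine I + e)%R by rewrite ltr_wpDl// fine_ge0.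
have t0 : (0 < 2 * (fine I + e) / W)%R by rewrite divr_gt0// mulr_gt0.
have := L_le _ t0.
have -> : (2^-1 * (2 * (fine I + e) / W) * W = fine I + e)%R.
  by field; rewrite gt_eqF.
rewrite -{1}(fineK Ifin) lee_fin lerDl ltW// => /(_ isT) LL.
have k0 : 0 <= (2^-1 * 2 `^ (- (a / b)))%:E :> \bar R.
  by rewrite lee_fin mulr_ge0 ?powR_ge0.
have := lee_wpmul2r (measure_ge0 omega Q) (lee_wpmul2l k0 LL).
move=> /= /le_trans; apply; rewrite WE -(fineK Ifin) -!EFinM -EFinD lee_fin.
have -> : (2^-1 * 2 `^ (- (a / b)) * (2 `^ (a / b) * (2 * (fine I + e) / W)) * W =
   (2 `^ (- (a / b)) * 2 `^ (a / b)) * (fine I + e))%R.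
  by field; rewrite gt_eqF.
rewrite -powRD ?addNr ?powRr0 ?mul1r//.
by apply/implyP => _; rewrite gt_eqF.
Qed.

(** There are countably many cubes, so those of measure zero have a null union. *)
Lemma null_cubes_negligible (R : realType) (d : nat)
    (mu : {measure set (borel_space R d) -> \bar R}) :
  {ae mu, forall x : borel_space R d,
    forall Q, dyadic Q -> Q x -> mu Q != 0}.
Proof.
have [e eD] := countable_range (countable_dyadic R d) (dyadic_nonempty R d).
have De n : dyadic (e n) by rewrite -eD; exists n.
pose Z n : set (borel_space R d) := if mu (e n) == 0 then e n else set0.
have : mu.-negligible (\bigcup_n Z n).
  apply: negligible_bigcup => n; rewrite /Z; case: ifPn => [/eqP Q0|_].
    by exists (e n); split=> //; exact: measurable_dyadic.
  exact: negligible_set0.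
apply: negligibleS => x /= nx; apply: contrapT => nZ; apply: nx => Q.
rewrite -eD => -[n _ <-] ex; apply/eqP => Q0; apply: nZ; exists n => //.
by rewrite /Z Q0 eqxx.
Qed.

(** * Lower bounds for the maximal operator *)

Section lower_bound.
Context (R : realType) (d : nat).
Variables (sigma omega : {measure set (borel_space R d) -> \bar R}).
Variable lambda : set 'rV[R]_d -> R.
(** On a cube with [sigma Q = 0] every average is 0 by the convention on [0/0], so the maximal
    operator ignores [lambda Q] while [local_sup] does not; [lnull] rules this out up to
    [omega]-null cubes. *)
Hypotheses (lfs : locally_finite sigma)
  (l0 : forall Q, dyadic Q -> (0 <= lambda Q)%R)
  (lnull : forall Q, dyadic Q -> sigma Q = 0 -> 0 < omega Q -> lambda Q = 0%R).

Lemma measurable_maximal (f : 'rV[R]_d -> R) :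
  measurable_fun [set: borel_space R d] (maximal lambda sigma f).
Proof. exact: measurable_sup_cubes. Qed.

Lemma average_ge (f : borel_space R d -> R) (c : R) (Q : set 'rV[R]_d) :
  measurable_fun [set: borel_space R d] f -> (0 <= c)%R -> dyadic Q ->
  (forall x, Q x -> c <= f x)%R -> sigma Q != 0 ->
  c%:E <= average sigma (EFin \o f) Q.
Proof.
move=> mf c0 dQ cf Q0; have mQ := measurable_dyadic dQ.
have Qfin : sigma Q \is a fin_num.
  by rewrite ge0_fin_numE//; exact: locally_finite_dyadic.
rewrite -[leLHS]mule1 -(mulVe Q0 Qfin) (muleC (sigma Q)^-1) muleA.
rewrite lee_wpmul2r ?inve_ge0// -integral_cst//; apply: ge0_le_integral => //.
  by apply: measurable_funTS; apply/measurable_EFinP; exact: measurableT_comp.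
by move=> x Qx /=; rewrite lee_fin (le_trans (cf _ Qx))// ler_norm.
Qed.

(** A cube [Q] inside [P] with [sigma Q != 0] has average at least [c], so it contributes at least
    [c lambda_Q] to the maximal function. The others satisfy [lambda Q = 0] or are [omega]-null, and
    almost every [x] avoids the latter. *)
Lemma local_sup_maximal (f : borel_space R d -> R) (c : R) (P : set 'rV[R]_d) :
  measurable_fun [set: borel_space R d] f -> (0 <= c)%R -> dyadic P ->
  (forall x, P x -> c <= f x)%R ->
  {ae omega, forall x : borel_space R d, P x ->
    c%:E * local_sup lambda P x <= maximal lambda sigma f x}.
Proof.
move=> mf c0 dP cf; apply: filterS (null_cubes_negligible omega) => x nz Px.
have [->|cn0] := eqVneq c 0%R; first by rewrite mul0e maximal_ge0.
have cp : (0 < c)%R by rewrite lt0r cn0.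
rewrite -lee_pdivlMl//; apply: sup_cubes_le.
  by rewrite mule_ge0 ?maximal_ge0// lee_fin invr_ge0.
move=> Q [dQ QP] Qx; rewrite lee_pdivlMl//.
have [Q0|Q0] := eqVneq (sigma Q) 0.
  rewrite lnull ?mule0 ?maximal_ge0//.
  by rewrite lt0e measure_ge0 nz.
apply: le_trans (le_sup_cubes (fun Q => (lambda Q)%:E * average sigma (EFin \o f) Q)
  dQ Qx).
rewrite muleC lee_wpmul2l ?lee_fin ?l0//; apply: average_ge => // y Qy.
exact/cf/QP.
Qed.

Lemma integral_local_sup_le (f : borel_space R d -> R) (c r : R)
    (P : set 'rV[R]_d) :
  measurable_fun [set: borel_space R d] f -> (0 <= c)%R -> (0 <= r)%R ->
  dyadic P -> (forall x, P x -> c <= f x)%R ->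
  (c `^ r)%:E *
    \int[omega]_(x in (P : set (borel_space R d))) local_sup lambda P x `^ r <=
  \int[omega]_(x in (P : set (borel_space R d))) maximal lambda sigma f x `^ r.
Proof.
move=> mf c0 r0 dP cf; have mP := measurable_dyadic dP.
rewrite -ge0_integralZl//; last 3 first.
- exact: measurable_funTS (measurable_local_sup_poweR _ _ _).
- by move=> x _; exact: poweR_ge0.
- by rewrite lee_fin powR_ge0.
apply: ae_ge0_le_integral => //.
- by move=> x _; rewrite mule_ge0 ?poweR_ge0// lee_fin powR_ge0.
- apply: emeasurable_funM => //.
  exact: measurable_funTS (measurable_local_sup_poweR _ _ _).
- by move=> x _; exact: poweR_ge0.
- apply: measurable_funTS.
  exact: measurableT_comp (measurable_poweR r) (measurable_maximal f).
apply: filterS (local_sup_maximal mf c0 dP cf) => x le Px.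
rewrite -poweR_EFin -poweRM ?lee_fin ?local_sup_ge0//.
apply: le_poweR => //; last exact: le.
by rewrite mule_ge0 ?local_sup_ge0.
Qed.

Variables (p q C : R).
Hypotheses (p1 : (1 < p)%R) (q0 : (0 < q)%R) (qp : (q < p)%R) (C0 : (0 <= C)%R)
  (lfo : locally_finite omega)
  (hC : forall f : borel_space R d -> R, f \in Lfun sigma p%:E ->
    'N[omega]_q%:E[maximal lambda sigma f] <= C%:E * 'N[sigma]_p%:E[EFin \o f]).

Lemma integral_maximal_norm_le (f : borel_space R d -> R) (Y : R) :
  measurable_fun [set: borel_space R d] f -> (0 <= Y)%R ->
  \int[sigma]_x (`|f x| `^ p)%:E = Y%:E ->
  \int[omega]_x maximal lambda sigma f x `^ q <= (C `^ q * Y `^ (q / p))%:E.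
Proof.
move=> mf Y0 fY.
have NE : 'N[sigma]_p%:E[EFin \o f] = (Y `^ p^-1)%:E.
  by rewrite unlock /= -[in RHS]poweR_EFin -fY.
have fL : f \in Lfun sigma p%:E.
  by apply/andP; rewrite !inE/= /finite_norm NE ltry.
have := hC fL; rewrite NE -EFinM => le.
have := le_poweR (ltW q0) (Lnorm_ge0 omega q%:E _) le.
rewrite poweR_Lnorm ?gt_eqF// poweR_EFin powRM ?powR_ge0// -powRrM.
rewrite (mulrC (p^-1)%R); congr (_ <= _).
by apply: eq_integral => x _; rewrite gee0_abs// maximal_ge0.
Qed.

(** Test on the indicator of [Q]: almost everywhere on [Q] the maximal function dominates
    [local_sup lambda Q], and [y^r <= 1 + y^q] reduces to the exponent of the norm inequality. *)
Lemma integral_local_sup_lty (r : R) (Q : set 'rV[R]_d) :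
  (0 <= r)%R -> (r <= q)%R -> dyadic Q ->
  \int[omega]_(x in (Q : set (borel_space R d))) local_sup lambda Q x `^ r < +oo.
Proof.
move=> r0 rq dQ; have mQ := measurable_dyadic dQ.
have mf : measurable_fun [set: borel_space R d] (\1_Q : _ -> R).
  exact: measurable_indic.
have := @integral_local_sup_le \1_Q 1%R r Q mf ler01 r0 dQ.
rewrite powR1 mul1e => /(_ _)/le_lt_trans; apply.
  by move=> x Qx; rewrite indicE mem_set.
have mM t : measurable_fun [set: borel_space R d]
    (fun x => maximal lambda sigma \1_Q x `^ t).
  exact: measurableT_comp (measurable_poweR t) (measurable_maximal _).
apply: (@le_lt_trans _ _ (\int[omega]_(x in (Q : set (borel_space R d)))
    (1 + maximal lambda sigma \1_Q x `^ q))).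
  apply: ge0_le_integral => //.
  - by move=> x _; exact: poweR_ge0.
  - exact: measurable_funTS.
  - by apply: emeasurable_funD => //; exact: measurable_funTS.
  move=> x _; have := maximal_ge0 sigma \1_Q x l0.
  case: (maximal _ _ _ x) => [y|_|//]; last first.
    by rewrite [in leRHS]poweRyr ?gt_eqF// addey// leey.
  rewrite lee_fin !poweR_EFin -EFinD lee_fin => y0.
  have [y1|y1] := leP y 1%R.
    apply: (@le_trans _ _ 1%R); last by rewrite lerDl powR_ge0.
    have <- : (1 `^ r = 1 :> R)%R by rewrite powR1.
    by apply: ge0_ler_powR; rewrite ?nnegrE.
  by apply: (@le_trans _ _ (y `^ q)%R); rewrite ?lerDr// ler_powR// ltW.
rewrite ge0_integralD//; last 2 first.
- by move=> x _; exact: poweR_ge0.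
- exact: measurable_funTS.
rewrite integral_cst// mul1e lte_add_pinfty//; first exact: locally_finite_dyadic.
apply: (@le_lt_trans _ _ (\int[omega]_x maximal lambda sigma \1_Q x `^ q)).
  by apply: ge0_subset_integral => // x _; exact: poweR_ge0.
have sQ : sigma Q \is a fin_num.
  by rewrite ge0_fin_numE//; exact: locally_finite_dyadic.
apply: (le_lt_trans (integral_maximal_norm_le (Y := fine (sigma Q)) mf _ _)).
- exact: fine_ge0.
- rewrite fineK// (_ : sigma Q = \int[sigma]_x (\1_Q x)%:E); last first.
    by rewrite integral_indic// setIT.
  apply: eq_integral => x _; rewrite ger0_norm// indicE.
  by case: (x \in Q); rewrite /= ?powR1// powR0// gt_eqF// (lt_trans _ p1).
- exact: ltry.
Qed.

(** Test on the indicator of [Q], whose maximal function vanishes. *)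
Lemma integral_local_sup_null (r : R) (Q : set 'rV[R]_d) :
  (0 < r)%R -> dyadic Q -> sigma Q = 0 ->
  \int[omega]_(x in (Q : set (borel_space R d))) local_sup lambda Q x `^ r = 0.
Proof.
move=> r0 dQ Q0; have mQ := measurable_dyadic dQ.
have mf : measurable_fun [set: borel_space R d] (\1_Q : _ -> R).
  exact: measurable_indic.
apply/eqP; rewrite eq_le integral_ge0 ?andbT; last first.
  by move=> x _; exact: poweR_ge0.
have := @integral_local_sup_le \1_Q 1%R r Q mf ler01 (ltW r0) dQ.
rewrite powR1 mul1e => /(_ _)/le_trans; apply.
  by move=> x Qx; rewrite indicE mem_set.
rewrite integral0_eq// => x _; rewrite (_ : maximal _ _ _ _ = 0).
  by rewrite poweR0r// gt_eqF.
apply/eqP; rewrite eq_le maximal_ge0// andbT; apply: sup_cubes_le => // P dP _.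
rewrite (_ : average _ _ _ = 0) ?mule0// /average.
rewrite (_ : \int[sigma]_(y in _) _ = 0) ?mul0e//.
have mP := measurable_dyadic dP.
under eq_integral do rewrite gee0_abs ?lee_fin//.
rewrite integral_indic//; apply: subset_measure0 Q0 => //.
exact: measurableI.
Qed.
End lower_bound.

(** Dividing by [Y^(q/p)] when [Y] is nonzero leaves [Y^((p-q)/p) <= D]. *)
Lemma absorb_power (R : realType) (p q Y D : R) :
  (0 < q)%R -> (q < p)%R -> (0 <= Y)%R -> (0 <= D)%R ->
  (Y <= D * Y `^ (q / p))%R -> (Y <= D `^ (p / (p - q)))%R.
Proof.
move=> q0 qp Y0 D0 le; have p0 : (0 < p)%R by exact: lt_trans qp.
have pq0 : (0 < p - q)%R by rewrite subr_gt0.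
have [->|Yn0] := eqVneq Y 0%R; first exact: powR_ge0.
have Yp : (0 < Y)%R by rewrite lt0r Yn0.
have YE : (Y = Y `^ ((p - q) / p) * Y `^ (q / p))%R.
  rewrite -powRD; last by apply/implyP => _; rewrite gt_eqF.
  by rewrite -mulrDl subrK divff ?gt_eqF// powRr1.
rewrite {1}YE ler_pM2r ?powR_gt0// in le.
have -> : Y = ((Y `^ ((p - q) / p)) `^ (p / (p - q)))%R.
  rewrite -powRrM (_ : (_ / _ * _ = 1)%R) ?powRr1//.
  by field; rewrite !gt_eqF.
apply: ge0_ler_powR; rewrite ?nnegrE ?powR_ge0//.
by rewrite divr_ge0 ?ltW.
Qed.

(* With [c P := (omega P / sigma P) `^ (1 / (p - q)) * Lambda P `^ (q / (p - q))]
   the summand [G P] of the necessary condition equals [(c P * Lambda P) `^ q],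
   and [c P `^ p * sigma P = G P * omega P]. The test function is
   [f := (\sum_P c P `^ p 1_P) `^ (1 / p)] over a subfamily on which [G] doubles. *)
Lemma integral_necessary_le (R : realType) (d : nat)
    (sigma omega : {measure set (borel_space R d) -> \bar R})
    (lambda : set 'rV[R]_d -> R) (p q r a kappa C : R)
    (s : seq (set 'rV[R]_d)) :
  locally_finite sigma -> locally_finite omega ->
  (forall Q, dyadic Q -> (0 <= lambda Q)%R) ->
  (forall Q, dyadic Q -> sigma Q = 0 -> 0 < omega Q -> lambda Q = 0%R) ->
  (1 < p)%R -> (0 < q)%R -> (q < p)%R -> (0 < a < q)%R -> (0 < kappa)%R ->
  (0 <= C)%R ->
  (forall f : borel_space R d -> R, f \in Lfun sigma p%:E ->
    'N[omega]_q%:E[maximal lambda sigma f] <= C%:E * 'N[sigma]_p%:E[EFin \o f]) ->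
  (forall Q, dyadic Q ->
    kappa%:E * Lambda_sup lambda omega r Q `^ a * omega Q <=
    \int[omega]_(x in (Q : set (borel_space R d))) local_sup lambda Q x `^ a) ->
  [set` s] `<=` @dyadic R d -> s != [::] ->
  \int[omega]_x sup_cubes [set` s]
    (fun Q => (omega Q / sigma Q) `^ (q / (p - q)) *
              Lambda_sup lambda omega r Q `^ ((p * q) / (p - q))) x <=
  (2 `^ ((q / a) / (q / a - 1)) *
   ((4 / kappa) `^ (q / a) * C `^ q) `^ (p / (p - q)))%:E.
Proof.
move=> lfs lfo l0 lnull p1 q0 qp /andP[a0 aq] k0 C0 hC Lk sd sn0.
have p0 : (0 < p)%R by exact: lt_trans p1.
have pq0 : (0 < p - q)%R by rewrite subr_gt0.
pose t := (q / a)%R; have t1 : (1 < t)%R by rewrite ltr_pdivlMr// mul1r.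
have t0 : (0 < t)%R by exact: lt_trans t1.
have t10 : (0 < t - 1)%R by rewrite subr_gt0.
have fsig Q : dyadic Q -> sigma Q < +oo by exact: locally_finite_dyadic.
have fom Q : dyadic Q -> omega Q < +oo by exact: locally_finite_dyadic.
pose sg Q := fine (sigma Q); pose om Q := fine (omega Q).
have sgE Q : dyadic Q -> sigma Q = (sg Q)%:E.
  by move=> dQ; rewrite fineK// ge0_fin_numE// fsig.
have omE Q : dyadic Q -> omega Q = (om Q)%:E.
  by move=> dQ; rewrite fineK// ge0_fin_numE// fom.
have sg0 Q : (0 <= sg Q)%R by exact: fine_ge0.
have om0 Q : (0 <= om Q)%R by exact: fine_ge0.
set G := fun Q => _ * _; pose L Q := Lambda_sup lambda omega r Q.
have L0 Q : 0 <= L Q.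
  rewrite /L /Lambda_sup /epow; case: ifPn => _; last exact: poweR_ge0.
  by rewrite inve_ge0 poweR_ge0.
have G0 Q : 0 <= G Q by rewrite mule_ge0 ?poweR_ge0.
pose good := [seq Q <- s | (0 < sg Q)%R && (0 < om Q)%R].
have goodP Q : Q \in good -> [/\ dyadic Q, (0 < sg Q)%R & (0 < om Q)%R].
  by rewrite mem_filter => /andP[/andP[sQ oQ] Qs]; split=> //; exact: sd.
(* If [omega Q = 0] the ratio vanishes. If only [sigma Q = 0] the ratio is [+oo], but [Lk] forces
   [Lambda] to be 0, and 0 times [+oo] is 0. *)
have bad Q : Q \in s -> Q \notin good -> G Q = 0.
  move=> Qs; have dQ := sd _ Qs; rewrite mem_filter Qs andbT negb_and -!leNgt.
  have [oQ _|on0] := eqVneq (om Q) 0%R.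
    by rewrite /G omE// oQ mul0e poweR0r ?mul0e// gt_eqF// divr_gt0.
  have op : (0 < om Q)%R by rewrite lt0r on0 om0.
  move=> /orP[sQ|]; last by rewrite leNgt op.
  have sQ0 : sigma Q = 0 by rewrite sgE//; apply/eqP; rewrite eqe eq_le sQ sg0.
  have := Lk _ dQ; rewrite (integral_local_sup_null lfs l0 lnull)//.
  rewrite omE// muleAC -EFinM => le.
  have La : L Q `^ a = 0.
    apply/eqP; rewrite eq_le poweR_ge0 andbT leNgt; apply/negP => Lp.
    by move: le; rewrite leNgt mule_gt0// lte_fin mulr_gt0.
  rewrite /G -/(L Q) (poweR_eq0_eq0 (L0 Q) La) poweR0r ?mule0//.
  by rewrite gt_eqF// divr_gt0// mulr_gt0.
pose l Q := fine (L Q).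
(* [Lambda] is finite by [Lk], since [integral_local_sup_lty] bounds the integral of order
   [a < q]. *)
have LE Q : Q \in good -> L Q = (l Q)%:E.
  move=> /goodP[dQ sQ oQ]; rewrite fineK// ge0_fin_numE//.
  apply: (@lty_poweRy _ _ a); rewrite ?gt_eqF//.
  have : kappa%:E * L Q `^ a * omega Q < +oo.
    apply: (le_lt_trans (Lk _ dQ)).
    apply: (integral_local_sup_lty lfs l0 lnull p1 q0 C0 lfo hC) => //;
      exact: ltW.
  rewrite omE// muleAC -EFinM; case: (L Q `^ a) => [z _|//|_]; rewrite ?ltry//.
  by rewrite gt0_muley// lte_fin mulr_gt0.
have l_ge0 Q : (0 <= l Q)%R by exact: fine_ge0.
pose c Q := ((om Q / sg Q) `^ (p - q)^-1 * l Q `^ (q / (p - q)))%R.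
have c0 Q : (0 <= c Q)%R by rewrite mulr_ge0 ?powR_ge0.
pose g Q := ((c Q * l Q) `^ q)%R.
have g0 Q : (0 <= g Q)%R by exact: powR_ge0.
have GE Q : Q \in good -> G Q = (g Q)%:E.
  move=> Qg; have [dQ sQ oQ] := goodP _ Qg.
  have iE : (sg Q)%:E^-1 = ((sg Q)^-1)%:E by rewrite /inve gt_eqF.
  rewrite /G -/(L Q) LE// omE// sgE// iE -(EFinM (om Q)) !poweR_EFin -EFinM.
  congr EFin; rewrite /g /c -(mulrA _ _ (l Q)).
  have lE : (l Q `^ (q / (p - q)) * l Q = l Q `^ (p / (p - q)))%R.
    rewrite mulrC [RHS]powR_mulB1 ?gt_eqF ?divr_gt0//.
    by congr (_ * _ `^ _)%R; field; rewrite gt_eqF.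
  rewrite lE powRM ?powR_ge0// -!powRrM.
  by congr (_ `^ _ * _ `^ _)%R; field; rewrite gt_eqF.
have cg Q : Q \in good -> (c Q `^ p * sg Q = g Q * om Q)%R.
  move=> Qg; have [dQ sQ oQ] := goodP _ Qg.
  have os0 : (0 < om Q / sg Q)%R by exact: divr_gt0.
  have gE : g Q = ((om Q / sg Q) `^ (q / (p - q)) * l Q `^ (p * q / (p - q)))%R.
    have iE : (sg Q)%:E^-1 = ((sg Q)^-1)%:E by rewrite /inve gt_eqF.
    apply: EFin_inj; rewrite -GE// /G -/(L Q) LE// omE// sgE// iE.
    by rewrite -(EFinM (om Q)) !poweR_EFin -EFinM.
  have -> : (om Q = om Q / sg Q * sg Q)%R by rewrite divfK ?gt_eqF.
  rewrite mulrA; congr (_ * _)%R; rewrite /c powRM ?powR_ge0// -!powRrM gE.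
  rewrite [RHS]mulrAC; congr (_ * _)%R; last by congr powR; field; rewrite gt_eqF.
  rewrite [RHS]mulrC [LHS]powR_mulB1 ?(ltW os0) ?mulf_neq0 ?invr_neq0 ?gt_eqF//.
  by congr (_ * _ `^ _)%R; field; rewrite gt_eqF.
(* On selected cubes this bounds from below the average of the power [a] of the maximal function. As
   [u^t] is a multiple of [g], selecting by [u^(t-1)] amounts to selecting by a power of [G]. *)
pose u Q := (kappa * (c Q * l Q) `^ a)%R.
have u0 Q : (0 <= u Q)%R by rewrite mulr_ge0 ?powR_ge0// ltW.
have ut Q : (u Q `^ t = kappa `^ t * g Q)%R.
  rewrite /u powRM ?powR_ge0 ?(ltW k0)// /g -powRrM /t mulrCA divff ?mulr1//.
  by rewrite gt_eqF.
have [||s0 [s0g cov pw]] := @doubling_subfamily R _ (fun Q => u Q `^ (t - 1))%R good.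
- by move=> Q _; exact: powR_ge0.
- by move=> P Q /goodP[dP _ _] /goodP[dQ _ _]; exact: dyadic_nested.
have s0P P : P \in s0 ->
    [/\ P \in good, dyadic P & measurable (P : set (borel_space R d))].
  move=> /s0g Pg; have [dP _ _] := goodP _ Pg.
  by split=> //; exact: measurable_dyadic.
pose S x := (\sum_(P <- s0) c P `^ p * \1_P x)%R.
have S0 x : (0 <= S x)%R by apply: sumr_ge0 => P _; rewrite mulr_ge0 ?powR_ge0.
have mS : measurable_fun [set: borel_space R d] S.
  by apply: measurable_sum_indic => P /s0P[].
pose f x := (S x `^ p^-1)%R.
have mf : measurable_fun [set: borel_space R d] f.
  exact: measurableT_comp (measurable_powR _) mS.
pose Y := (\sum_(P <- s0) g P * om P)%R.
have Y0 : (0 <= Y)%R by apply: sumr_ge0 => P _; rewrite mulr_ge0.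
have YE : \sum_(P <- s0) (g P)%:E * omega P = Y%:E.
  rewrite /Y -sumEFin big_seq [RHS]big_seq; apply: eq_bigr => P /s0P[_ dP _].
  by rewrite omE.
have fY : \int[sigma]_x (`|f x| `^ p)%:E = Y%:E.
  rewrite (_ : \int[sigma]_x _ = \int[sigma]_x (S x)%:E); last first.
    apply: eq_integral => x _; rewrite ger0_norm ?powR_ge0// -powRrM.
    by rewrite mulVf ?gt_eqF// powRr1.
  rewrite integral_sum_indic; last 2 first.
  - by move=> P /s0P[].
  - by move=> P _; exact: powR_ge0.
  rewrite -YE big_seq [RHS]big_seq; apply: eq_bigr => P /s0P[Pg dP _].
  by rewrite sgE// omE// -!EFinM cg.
have cf P x : P \in s0 -> P x -> (c P <= f x)%R.
  move=> Ps Px; rewrite -[leLHS](powRr1 (c0 P)) -(@mulfV _ p) ?gt_eqF// powRrM.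
  apply: ge0_ler_powR; rewrite ?nnegrE ?powR_ge0 ?invr_ge0 ?(ltW p0)//.
  by apply: (le_sum_indic (c := fun Q => (c Q `^ p)%R)) => // Q; exact: powR_ge0.
have ca := @carleson_embedding _ (borel_space R d) R omega t u s0
  (fun x => maximal lambda sigma f x `^ a) t1.
(* [carleson_embedding] for [omega] and [M(f sigma)^a], followed by the norm inequality for [f],
   where [f^p] has integral [Y]. *)
have {ca}YD : (Y <= (4 / kappa) `^ t * C `^ q * Y `^ (q / p))%R.
  have kt0 : (0 < kappa `^ t)%R by rewrite powR_gt0.
  have : (kappa `^ t)%:E * Y%:E <= (4 `^ t)%:E * (C `^ q * Y `^ (q / p))%:E.
    rewrite -YE ge0_sume_distrr; last by move=> P _; rewrite mule_ge0 ?lee_fin.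
    rewrite (eq_bigr (fun P => (u P `^ t)%:E * omega P)); last first.
      by move=> P _; rewrite ut EFinM muleA.
    apply: (le_trans (ca _ _ _ _ _ _ _)) => //.
    - exact: measurableT_comp (measurable_poweR a) (measurable_maximal _ _ _).
    - by move=> x; exact: poweR_ge0.
    - by move=> P /s0P[].
    - by move=> P /s0P[_ dP _]; exact: fom.
    - move=> P Ps; have [Pg dP mP] := s0P _ Ps.
      apply: le_trans (integral_local_sup_le lfs l0 lnull mf (c0 P) (ltW a0) dP _).
        rewrite /u powRM// (mulrC (c P `^ a)%R) mulrA EFinM (muleC _ (c P `^ a)%:E).
        rewrite -muleA lee_wpmul2l ?lee_fin ?powR_ge0//.
        by have := Lk _ dP; rewrite -/(L P) LE// poweR_EFin EFinM.
      by move=> x; exact: cf.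
    rewrite lee_wpmul2l ?lee_fin ?powR_ge0//.
    rewrite (_ : \int[omega]_x _ = \int[omega]_x maximal lambda sigma f x `^ q).
      exact: (integral_maximal_norm_le l0 q0 C0 hC).
    apply: eq_integral => x _; rewrite -poweRrM; congr (_ `^ _).
    by rewrite /t mulrCA divff ?mulr1// gt_eqF.
  rewrite -!EFinM lee_fin -ler_pdivlMl// => /le_trans; apply.
  rewrite powRM ?invr_ge0 ?(ltW k0)//.
  rewrite -(@powR_inv1 _ kappa) ?(ltW k0)// -powRrM mulN1r powRN.
  by rewrite -!mulrA mulrCA.
have Yle := absorb_power q0 qp Y0 _ YD.
have D0 : (0 <= (4 / kappa) `^ t * C `^ q)%R by rewrite mulr_ge0 ?powR_ge0.
have {}Yle := Yle D0.
rewrite -/t.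
apply: (@le_trans _ _ (\int[omega]_x
    (\sum_(P <- s0) 2 `^ (t / (t - 1)) * g P * \1_P x)%:E)).
  apply: ge0_le_integral => //.
  - move=> x _; case: s sn0 {sd good bad goodP LE GE cg s0P s0g cov} => // Q s' _.
    by apply: (@sup_cubes_ge0 _ _ _ _ Q); [exact: mem_head|exact: G0].
  - exact: measurable_sup_cubes.
  - by apply/measurable_EFinP; apply: measurable_sum_indic => P /s0P[].
  have T0 (P : set 'rV[R]_d) x : (0 <= 2 `^ (t / (t - 1)) * g P * \1_P x)%R.
    by rewrite !mulr_ge0 ?powR_ge0.
  move=> x _; apply: sup_cubes_le; first by rewrite lee_fin; exact: sumr_ge0.
  move=> Q Qs Qx; have [Qg|Qb] := boolP (Q \in good); last first.
    by rewrite bad// lee_fin; exact: sumr_ge0.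
  (* Every good cube lies in a selected one whose [g] is smaller by at most the factor
     [2^(t/(t-1))]. *)
  have [P Ps [QP wQP]] := cov _ Qg.
  rewrite GE// lee_fin; apply: le_trans (le_sum_indic
    (c := fun P => (2 `^ (t / (t - 1)) * g P)%R) _ Ps (QP _ Qx)); last first.
    by move=> P'; rewrite mulr_ge0 ?powR_ge0.
  have := ge0_powR_mono t10 (ltW t0) (u0 Q) (u0 P) wQP.
  by rewrite !ut mulrCA ler_pM2l// powR_gt0.
rewrite integral_sum_indic; last 2 first.
- by move=> P /s0P[].
- by move=> P _; rewrite mulr_ge0 ?powR_ge0.
rewrite (eq_bigr
  (fun P => (2 `^ (t / (t - 1)))%:E * ((g P)%:E * omega P))); last first.
  by move=> P _; rewrite EFinM muleA.
rewrite -ge0_sume_distrr; last by move=> P _; rewrite mule_ge0 ?lee_fin.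
by rewrite YE -EFinM lee_fin ler_wpM2l ?powR_ge0.
Qed.

Lemma necessary_condition (R : realType) (p q epsilon : R) :
  (1 < p)%R -> (0 < q)%R -> (q < p)%R -> (0 < epsilon)%R ->
  (q - epsilon != 0)%R ->
  exists c : R, (0 < c)%R /\
    forall (d : nat) (sigma omega : {measure set (borel_space R d) -> \bar R})
      (lambda : set 'rV[R]_d -> R),
      locally_finite sigma -> locally_finite omega ->
      (forall Q, dyadic Q -> 0 <= lambda Q)%R ->
      (forall Q, dyadic Q -> sigma Q = 0 -> 0 < omega Q -> lambda Q = 0%R) ->
      (\int[omega]_x
          sup_cubes (@dyadic R d)
            (fun Q => (omega Q / sigma Q) `^ (q / (p - q))
                      * Lambda_sup lambda omega (q - epsilon) Q
                          `^ ((p * q) / (p - q))) x)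
       `^ ((p - q) / (p * q))
       <= c%:E * maximal_norm lambda sigma omega p q.
Proof.
move=> p1 q0 qp e0 qe0.
have p0 : (0 < p)%R by exact: lt_trans p1.
have pq0 : (0 < p - q)%R by rewrite subr_gt0.
have qeq : (q - epsilon < q)%R by lra.
(* The loss of [epsilon] leaves room for an exponent [a < q], so that [q/a > 1] as
   [carleson_embedding] requires. *)
have [a [kappa [aq k0 Lk]]] := Lambda_sup_le q0 qeq qe0.
set th := ((p - q) / (p * q))%R.
have th0 : (0 <= th)%R by rewrite divr_ge0 ?ltW// mulr_gt0.
pose t := (q / a)%R; pose e := (p / (p - q))%R.
pose K1 : R := (2 `^ (t / (t - 1)))%R; pose K2 : R := ((4 / kappa) `^ t)%R.
have K20 : (0 < K2)%R by rewrite powR_gt0// divr_gt0.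
have K10 : (0 < K1)%R by exact: powR_gt0.
have c0 : (0 < (K1 * K2 `^ e) `^ th)%R by rewrite powR_gt0// mulr_gt0// powR_gt0.
exists ((K1 * K2 `^ e) `^ th)%R; split=> // d sigma omega lambda lfs lfo l0 lnull.
(* The norm is an infimum, so it suffices to treat each admissible constant [C]. *)
rewrite -lee_pdivrMl//; apply: le_ereal_inf_tmp => _ [C [C0 hC] <-].
rewrite lee_pdivrMl//.
apply: (@le_trans _ _ ((K1 * (K2 * C `^ q) `^ e)%:E `^ th)).
  apply: le_poweR => //.
    apply: integral_ge0 => x _; have [Q dQ] := dyadic_nonempty R d.
    by apply: (sup_cubes_ge0 _ dQ); rewrite mule_ge0 ?poweR_ge0.
  apply: integral_sup_cubes_le => //; first exact: dyadic_nonempty.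
    by move=> Q _; rewrite mule_ge0 ?poweR_ge0.
  move=> s sd sn0; apply: integral_necessary_le => // Q dQ.
  by apply: Lk => //; exact: locally_finite_dyadic.
rewrite poweR_EFin -EFinM lee_fin (powRM _ (ltW K20) (powR_ge0 _ _)) mulrA.
rewrite [leLHS]powRM ?mulr_ge0 ?powR_ge0 ?(ltW K10)// -!(powRrM C).
(* The exponents of [C] multiply to one, so the bound is linear in [C]. *)
have -> : (q * e * th = 1)%R.
  by rewrite /e /th; field; rewrite !gt_eqF.
by rewrite powRr1.
Qed.

Local Close Scope ereal_scope.

Theorem proposition2p1 (R : realType) (p q : R)
    (hp : 1 < p) (hq : 0 < q) (hqp : q < p) :
  (exists c : R, 0 < c /\
    forall (d : nat) (sigma omega : {measure set (borel_space R d) -> \bar R})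
      (lambda : set 'rV[R]_d -> R),
      locally_finite sigma -> locally_finite omega ->
      (forall Q, dyadic Q -> 0 <= lambda Q) ->
      (maximal_norm lambda sigma omega p q
       <= c%:E *
          (\int[omega]_x
             sup_cubes (@dyadic R d)
               (fun Q => (omega Q / sigma Q) `^ (q / (p - q))
                         * (lambda Q `^ q)%:E
                         * Lambda_sup lambda omega q Q
                             `^ (q ^+ 2 / (p - q))) x)
          `^ ((p - q) / (p * q)))%E)
  /\
  (forall epsilon : R, 0 < epsilon -> q - epsilon != 0 ->
   exists c : R, 0 < c /\
    forall (d : nat) (sigma omega : {measure set (borel_space R d) -> \bar R})
      (lambda : set 'rV[R]_d -> R),
      locally_finite sigma -> locally_finite omega ->
      (forall Q, dyadic Q -> 0 <= lambda Q) ->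
      (forall Q, dyadic Q -> sigma Q = 0%E -> (0 < omega Q)%E ->
         lambda Q = 0) ->
      ((\int[omega]_x
          sup_cubes (@dyadic R d)
            (fun Q => (omega Q / sigma Q) `^ (q / (p - q))
                      * Lambda_sup lambda omega (q - epsilon) Q
                          `^ ((p * q) / (p - q))) x)
       `^ ((p - q) / (p * q))
       <= c%:E * maximal_norm lambda sigma omega p q)%E).
Proof.
split; first exact: sufficient_condition.
by move=> epsilon e0 qe0; exact: necessary_condition.
Qed.
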